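(* Let $A$ be a $C^{*}$-algebra, let $I$ be an ideal in $A$, and let $\pi:A\rightarrow A/I$ be the quotient map. If $x$ is an element of $A$, then for any natural number $N$ there is an element $\bar{x}$ in $A$ such that $\pi(\bar{x})=\pi(x)$ and \[ \left\Vert \bar{x}^{n}\right\Vert = \left\Vert \pi\left(x^{n}\right)\right\Vert \quad\text{for all } n=1,\ldots,N. \]
   Context: Ideals of $C^{*}$-algebras are closed and two-sided, so $A/I$ is a $C^{*}$-algebra with the quotient norm. *)

(* Defs.v *)
From HB Require Import structures.
From mathcomp Require Import all_boot all_order all_algebra ring_quotient.
From mathcomp Require Import all_classical all_reals all_analysis.
From mathcomp Require Export complex.

Set Implicit Arguments.
Unset Strict Implicit.
Unset Printing Implicit Defensive.
Import Order.TTheory GRing.Theory Num.Theory.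
Import numFieldNormedType.Exports.
Local Open Scope classical_set_scope.
Local Open Scope ring_scope.
Local Open Scope complex_scope.
Local Open Scope quotient_scope.

(* Complex C*-algebras. No unit is required, and the zero algebra is allowed;
   since MathComp rings are unital, the product is an operation of its own.
   As for every normedModType R[i], the norm is R[i]-valued (and real). *)
HB.mixin Record isCStarAlgebra (R : realType) A
    of CompleteNormedModule R[i] A := {
  cmul : A -> A -> A;
  cstar : A -> A;
  cmulA : forall x y z, cmul x (cmul y z) = cmul (cmul x y) z;
  cmulDl : forall x y z, cmul (x + y) z = cmul x z + cmul y z;
  cmulDr : forall x y z, cmul x (y + z) = cmul x y + cmul x z;
  cmulZl : forall (c : R[i]) x y, cmul (c *: x) y = c *: cmul x y;
  cmulZr : forall (c : R[i]) x y, cmul x (c *: y) = c *: cmul x y;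
  cstarK : forall x, cstar (cstar x) = x;
  cstarD : forall x y, cstar (x + y) = cstar x + cstar y;
  cstarZ : forall (c : R[i]) x, cstar (c *: x) = c^* *: cstar x;
  cstarM : forall x y, cstar (cmul x y) = cmul (cstar y) (cstar x);
  norm_cmul_le : forall x y, `|cmul x y| <= `|x| * `|y|;
  norm_cstar_mul : forall x, `|cmul (cstar x) x| = `|x| ^+ 2
}.

#[short(type="cstarAlgType")]
HB.structure Definition CStarAlgebra (R : realType) :=
  {A of isCStarAlgebra R A & CompleteNormedModule R[i] A}.

(* x ^ n for n >= 1; the value at n = 0 is junk, as there may be no unit. *)
Definition cpow (R : realType) (A : cstarAlgType R) (x : A) (n : nat) : A :=
  iterop n cmul x 0.

Record ideal (R : realType) (A : cstarAlgType R) := Ideal {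
  ideal_set :> set A;
  ideal0 : ideal_set 0;
  idealD : forall x y, ideal_set x -> ideal_set y -> ideal_set (x + y);
  idealZ : forall (c : R[i]) x, ideal_set x -> ideal_set (c *: x);
  idealMl : forall a x, ideal_set x -> ideal_set (cmul a x);
  idealMr : forall a x, ideal_set x -> ideal_set (cmul x a);
  ideal_closed : closed ideal_set
}.


Section Quotient.
Context (R : realType) (A : cstarAlgType R) (I : ideal A).

Definition ideal_pred : {pred A} := mem (ideal_set I).

Lemma in_ideal_pred x : (x \in ideal_pred) = `[< ideal_set I x >].
Proof. by []. Qed.

Lemma idealN x : ideal_set I x -> ideal_set I (- x).
Proof. by move=> Ix; rewrite -scaleN1r; apply: idealZ. Qed.

Lemma ideal_zmod_closed : zmod_closed ideal_pred.
Proof.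
split=> [|x y]; rewrite !in_ideal_pred; first by apply/asboolP/ideal0.
by move=> /asboolP Ix /asboolP Iy; apply/asboolP/idealD/idealN.
Qed.

HB.instance Definition _ :=
  GRing.isZmodClosed.Build A ideal_pred ideal_zmod_closed.

Definition cquot : Type := {ideal_quot ideal_pred}.

HB.instance Definition _ := GRing.Zmodule.on cquot.
HB.instance Definition _ := Quotient.on cquot.

Lemma pi_cquotP x y : \pi_cquot x = \pi_cquot y <-> ideal_set I (x - y).
Proof.
rewrite (rwP eqP) -(Quotient.idealrBE ideal_pred) in_ideal_pred.
by split=> /asboolP.
Qed.

Lemma pi_cquotD x y : \pi_cquot (x + y) = \pi_cquot x + \pi_cquot y.
Proof. exact: (@pi_addr _ _ _ _ _ {ideal_quot ideal_pred}). Qed.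

Lemma pi_cquotN x : \pi_cquot (- x) = - \pi_cquot x.
Proof. exact: (@pi_oppr _ _ _ _ _ {ideal_quot ideal_pred}). Qed.

Lemma pi_cquot0 : \pi_cquot 0 = 0.
Proof. exact: (@pi_zeror _ _ _ _ _ {ideal_quot ideal_pred}). Qed.

Lemma pi_cquotMn x n : \pi_cquot (x *+ n) = \pi_cquot x *+ n.
Proof.
by elim: n => [|n IHn]; rewrite ?mulr0n ?pi_cquot0// !mulrS pi_cquotD IHn.
Qed.

(* complex.Re only turns the real number `|a| : R[i] into an element of R. *)
Definition quot_norm_set (q : cquot) : set R :=
  [set complex.Re `|a| | a in [set a : A | \pi_cquot a = q]].

Definition quot_norm (q : cquot) : R[i] := (inf (quot_norm_set q))%:C.

Let Re_norm (a : A) : (complex.Re `|a|)%:C = `|a|.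
Proof. by rewrite RRe_real. Qed.

Let Re_norm_ge0 (a : A) : 0 <= complex.Re `|a|.
Proof. by rewrite -lecR Re_norm normr_ge0. Qed.

Let inf_ub (a : A) : inf (quot_norm_set (\pi_cquot a)) <= complex.Re `|a|.
Proof.
apply: ge_inf; last by exists a.
by exists 0 => _ [b _ <-].
Qed.

Let set_neq0 q : quot_norm_set q !=set0.
Proof. by exists (complex.Re `|repr q|), (repr q) => //=; rewrite reprK. Qed.

Let lb_inf q r :
  (forall a, \pi_cquot a = q -> r <= complex.Re `|a|) ->
  r <= inf (quot_norm_set q).
Proof. by move=> h; apply: lb_le_inf => // _ [a qa <-]; apply: h. Qed.

Lemma quot_norm_ler_normD p q : quot_norm (p + q) <= quot_norm p + quot_norm q.
Proof.
rewrite /quot_norm -raddfD lecR -lerBlDr; apply: lb_inf => a pa.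
rewrite lerBlDr -lerBlDl; apply: lb_inf => b qb.
rewrite lerBlDl -pa -qb -pi_cquotD (le_trans (inf_ub _))//.
by rewrite -lecR raddfD/= !Re_norm ler_normD.
Qed.

Lemma quot_normN q : quot_norm (- q) = quot_norm q.
Proof.
suff le p : inf (quot_norm_set (- p)) <= inf (quot_norm_set p).
  congr (_%:C); apply/le_anti/andP; split; first exact: le.
  by rewrite -[in leLHS](opprK q) le.
by apply: lb_inf => a <-; rewrite -pi_cquotN -(normrN a) inf_ub.
Qed.

Lemma quot_norm0 : quot_norm 0 = 0.
Proof.
congr (_%:C); apply/le_anti/andP; split; last by apply: lb_inf => a _.
by rewrite -pi_cquot0 (le_trans (inf_ub _))// normr0.
Qed.

Lemma quot_norm_mulrn q n : quot_norm (q *+ n) = quot_norm q *+ n.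
Proof.
case: n => [|n]; first by rewrite !mulr0n quot_norm0.
rewrite /quot_norm -raddfMn/=; congr (_%:C); apply/le_anti/andP; split.
  rewrite -mulr_natr -ler_pdivrMr ?ltr0n//; apply: lb_inf => a <-.
  rewrite ler_pdivrMr ?ltr0n// -pi_cquotMn (le_trans (inf_ub _))//.
  by rewrite normrMn raddfMn/= mulr_natr.
apply: lb_inf => b qb; pose k : R[i] := n.+1%:R.
have k0 : k != 0 by rewrite pnatr_eq0.
have bE : b = (k^-1 *: b) *+ n.+1.
  by rewrite -scaler_nat scalerA divff// scale1r.
have qE : q = \pi_cquot (k^-1 *: b).
  rewrite -[q]reprK; apply/pi_cquotP.
  have -> : repr q - k^-1 *: b = k^-1 *: (repr q *+ n.+1 - b).
    by rewrite scalerBr -scaler_nat scalerA mulVf// scale1r.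
  by apply: idealZ; apply/pi_cquotP; rewrite pi_cquotMn reprK.
by rewrite [in leRHS]bE normrMn raddfMn/= lerMn2r/= qE inf_ub.
Qed.

Lemma quot_norm_eq0 q : quot_norm q = 0 -> q = 0.
Proof.
rewrite /quot_norm => /(congr1 (@complex.Re R))/= q0.
rewrite -[q]reprK -pi_cquot0; apply/pi_cquotP; rewrite subr0.
apply: (@ideal_closed _ _ I) => B /nbhs_ballP[e /= e0 eB].
have Re_e0 : 0 < complex.Re e by move: e0; rewrite ltcE => /andP[].
have eE : (complex.Re e)%:C = e by rewrite RRe_real// gtr0_real.
have [|_ [b qb <-]] := @inf_adherent _ (quot_norm_set q) _ Re_e0.
  by split=> //; exists 0 => _ [b _ <-].
rewrite q0 add0r => be; exists (repr q - b); split.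
  by apply/pi_cquotP; rewrite reprK.
apply: eB; rewrite -ball_normE/= opprB addrCA subrr addr0.
by rewrite -Re_norm -eE ltcR.
Qed.

HB.instance Definition _ := Num.Zmodule_isNormed.Build R[i] cquot
  quot_norm_ler_normD quot_norm_eq0 quot_norm_mulrn quot_normN.

End Quotient.

(* Main.v *)
From HB Require Import structures.
Require Import Defs.
From mathcomp Require Import all_boot all_order all_algebra.
From mathcomp Require Import all_classical all_reals all_analysis.
From mathcomp Require Import cyclic separable cyclotomic.
From Stdlib Require Import -(notations) Ncring Ncring_tac.
From mathcomp Require Import ring lra zify.
Set Implicit Arguments.
Unset Strict Implicit.
Unset Printing Implicit Defensive.
Import Order.TTheory GRing.Theory Num.Theory.
Import numFieldNormedType.Exports.
Local Open Scope classical_set_scope.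
Local Open Scope ring_scope.
Local Open Scope complex_scope.
Local Open Scope quotient_scope.

(** Put c n = ||pi (x^n)||.  Every lift y of pi x satisfies ||y^n|| >= c n, so
    the point is to find a lift with ||y^n|| <= c n for n = 1, ..., N.  It is
    the limit of a sequence of lifts whose excess over the numbers c n tends to
    0.  For this it is enough that, for every D > 0, there is an a > 0 such
    that each lift with ||y^n|| <= c n + a can be moved by at most D to a lift
    with ||y^n|| <= c n + e, where e > 0 is arbitrary ([power_adjust], iterated
    in [power_lift]).  If some c n vanishes, let k be the first such index: only
    the exponents up to k matter, because the limit has y^k = 0.

    Two moves achieve this.

    Rescaling ([norm_adjust]).  Replace y by y (1 - t u) with u in I almost
    commuting with y and acting almost like a unit on a large part of I.  Where
    u is close to 1, the n-th power is multiplied by (1 - t)^n; where u is close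
    to 0, y looks like pi y.  So ||(y (1 - t u))^n|| is almost bounded by
    max (c n, (1 - t) ||y^n||).  If c n > 0, a number t of the order of a
    removes the excess a.

    Making y almost nilpotent when c k = 0 ([nilpotent_adjust]).  Take f and g,
    functions of y y^*, both close to a spectral projection away from 0, with
    (1 - f) g = 0.  Then y is close to g y = g y (1 - f) + g y f, and the
    (k-1)-st power of y1 = g y f is small if y^k is small.  By induction y1 is
    close to some z in g A with z^(k-1) = 0, and g y (1 - f) + z has k-th power
    0, as both its terms are killed by 1 - f from the left.  For y itself the
    cut has to be coarse, because y^k is only moderately small, but modulo I it
    has to be fine, so as to move pi y very little; hence f and g are obtained
    by glueing a coarse and a fine cutoff along an element of I
    ([glue_cutoffs]).  What is lost modulo I is restored by a small correction
    ([nilpotent_lift_adjust]).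

    Both moves rest on two facts.  A real polynomial p in a self-adjoint
    contraction h satisfies ||p(h)|| <= sup |p| over [-1, 1] ([opn_pev]): h is
    the real part of a unitary, and the coefficients of a polynomial in a
    unitary are controlled by its values on the circle.  Averages of successive
    approximate units of I almost commute with any given finite set
    ([quasi_central]). *)

(** * Identities in noncommutative rings *)

Section NcRing.
Context (U : nzRingType).
Local Instance ncring_ops :
  @Ring_ops U 0 1 +%R *%R (fun x y => x - y) (@GRing.opp U) eq := {}.
Local Instance ncring_ring :
  @Ring U 0 1 +%R *%R (fun x y => x - y) (@GRing.opp U) eq ncring_ops.
Proof.
constructor; try typeclasses eauto;
  rewrite /addition /multiplication /subtraction /opposite /equality
    /add_notation /mul_notation /sub_notation /opp_notation /eq_notation
    /zero /one /zero_notation /one_notation/=; try by move=> *; subst.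
- exact: add0r.
- exact: addrC.
- exact: addrA.
- exact: mul1r.
- exact: mulr1.
- exact: mulrA.
- exact: mulrDl.
- move=> x y z; exact: mulrDr.
- exact: subrr.
Qed.
End NcRing.
#[global] Existing Instance ncring_ops.
#[global] Existing Instance ncring_ring.

(** Decides identities of noncommutative rings; since it treats scaled elements
    as atoms, scalars have to be moved out of products first.  An identity in
    the algebra [A], which has its own product, is proved in the unitization. *)
Ltac ncring := rewrite ?(expr2, mulr2n); non_commutative_ring.

(** * Real-valued norm of a C*-algebra *)

Lemma Re_norm_real (R : realType) (r : R) : complex.Re `|r%:C| = `|r|.
Proof. by rewrite normc_def/= expr0n addr0 sqrtr_sqr. Qed.

Lemma Re_norm_ge0 (R : realType) (c : R[i]) : 0 <= complex.Re `|c|.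
Proof. by rewrite normc_def sqrtr_ge0. Qed.

Section RealNorm.
Context (R : realType) (A : cstarAlgType R).
Implicit Types (x y : A) (c : R[i]).

(** The norm of [A] takes real values, but in [R[i]]; working in [R] gives access
    to its total order. *)
Definition nm x : R := complex.Re `|x|.

Lemma nmE x : (nm x)%:C = `|x|.
Proof. by rewrite /nm RRe_real. Qed.

Lemma nm_ge0 x : 0 <= nm x.
Proof. by rewrite -lecR nmE normr_ge0. Qed.

Lemma nm0 : nm 0 = 0.
Proof. by rewrite /nm normr0. Qed.

Lemma nm0_eq0 x : nm x = 0 -> x = 0.
Proof. by move=> x0; apply/eqP; rewrite -normr_eq0 -nmE x0. Qed.

Lemma nmD x y : nm (x + y) <= nm x + nm y.
Proof. by rewrite -lecR rmorphD/= !nmE ler_normD. Qed.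

Lemma nmN x : nm (- x) = nm x.
Proof. by rewrite /nm normrN. Qed.

Lemma nmZ c x : nm (c *: x) = complex.Re `|c| * nm x.
Proof.
apply: complexI; rewrite rmorphM/= !nmE normrZ.
by congr (_ * _); rewrite RRe_real.
Qed.

Lemma nmZr (r : R) x : nm (r%:C *: x) = `|r| * nm x.
Proof. by rewrite nmZ Re_norm_real. Qed.

Lemma nmM x y : nm (cmul x y) <= nm x * nm y.
Proof. by rewrite -lecR rmorphM/= !nmE norm_cmul_le. Qed.

Lemma nm_cstarM x : nm (cmul (cstar x) x) = nm x ^+ 2.
Proof. by apply: complexI; rewrite rmorphXn/= !nmE norm_cstar_mul. Qed.

(** The C*-identity gives ||y||^2 = ||y^* y|| <= ||y^*|| ||y||. *)
Lemma nm_cstar x : nm (cstar x) = nm x.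
Proof.
suff le y : nm y <= nm (cstar y).
  by apply/le_anti; rewrite le andbT; move: (le (cstar x)); rewrite cstarK.
have [->|y0] := eqVneq (nm y) 0; first exact: nm_ge0.
have yp : 0 < nm y by rewrite lt_def y0 nm_ge0.
by rewrite -(ler_pM2r yp) -expr2 -nm_cstarM nmM.
Qed.

Lemma cmul0l x : cmul 0 x = 0.
Proof. by have := cmulZl 0 (0 : A) x; rewrite !scale0r. Qed.

Lemma cmul0r x : cmul x 0 = 0.
Proof. by have := cmulZr 0 x (0 : A); rewrite !scale0r. Qed.

Lemma cstarB x y : cstar (x - y) = cstar x - cstar y.
Proof.
by apply/eqP; rewrite eq_sym subr_eq -cstarD subrK.
Qed.

End RealNorm.

(** * Unitization and operator seminorm *)

Section Unitization.
Context (R : realType) (A : cstarAlgType R).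

(** The pair (c, a) stands for c + a.  The scalars are [R[i]^o] so that the
    product carries a module structure over [R[i]]. *)
Definition unitization : Type := (R[i]^o * A)%type.
HB.instance Definition _ := GRing.Lmodule.on unitization.
Local Notation U := unitization.
Implicit Types (S T : U) (a b v w : A) (c : R[i]).

Definition umul S T : U :=
  (S.1 * T.1, S.1 *: T.2 + T.1 *: S.2 + cmul S.2 T.2).
Definition uone : U := (1, 0).

Lemma umulA : associative umul.
Proof.
move=> S T V; congr pair; rewrite /= ?mulrA//.
rewrite !cmulDl !cmulDr !scalerDr !cmulZl !cmulZr !scalerA cmulA.
rewrite -!addrA; congr (_ + _); rewrite (mulrC V.1 S.1); congr (_ + _).
rewrite (mulrC V.1 T.1).
by rewrite [LHS]addrCA; congr (_ + _); rewrite [RHS]addrCA; congr (_ + _);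
  rewrite addrCA.
Qed.

Lemma umul1l : left_id uone umul.
Proof.
by case=> c a; congr pair; rewrite /= ?mul1r// scale1r scaler0 cmul0l !addr0.
Qed.

Lemma umul1r : right_id uone umul.
Proof.
by case=> c a; congr pair; rewrite /= ?mulr1// scale1r scaler0 cmul0r add0r addr0.
Qed.

Lemma umulDl : left_distributive umul +%R.
Proof.
move=> S T V; congr pair; rewrite /= ?mulrDl//.
by rewrite !scalerDl scalerDr cmulDl -!addrA; congr (_ + _);
  rewrite addrCA; congr (_ + _); rewrite [RHS]addrCA; congr (_ + _);
  rewrite addrCA.
Qed.

Lemma umulDr : right_distributive umul +%R.
Proof.
move=> S T V; congr pair; rewrite /= ?mulrDr//.
by rewrite !scalerDl scalerDr cmulDr -!addrA; congr (_ + _);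
  rewrite addrCA; congr (_ + _); rewrite [RHS]addrCA; congr (_ + _);
  rewrite addrCA.
Qed.

Lemma uone_neq0 : uone != 0 :> U.
Proof. by apply/eqP => -[/eqP]; rewrite oner_eq0. Qed.

HB.instance Definition _ := GRing.Zmodule_isNzRing.Build U
  umulA umul1l umul1r umulDl umulDr uone_neq0.

Lemma uscaleAl c S T : c *: (S * T) = c *: S * T.
Proof.
congr pair; rewrite /= -?mulrA//.
by rewrite !scalerDr cmulZl !scalerA (mulrC c T.1).
Qed.

HB.instance Definition _ := GRing.Lmodule_isLalgebra.Build R[i] U uscaleAl.

Lemma uscaleAr c S T : c *: (S * T) = S * (c *: T).
Proof.
congr pair; first exact: (@mulrCA R[i] c S.1 T.1).
by rewrite /= !scalerDr cmulZr !scalerA (mulrC c S.1).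
Qed.

HB.instance Definition _ := GRing.Lalgebra_isAlgebra.Build R[i] U uscaleAr.

Lemma mulUE S T :
  S * T = (S.1 * T.1, S.1 *: T.2 + T.1 *: S.2 + cmul S.2 T.2).
Proof. by []. Qed.

Definition inA a : U := (0, a).

Lemma inA_is_linear : linear inA.
Proof. by move=> c a b; congr pair; rewrite /= scaler0 addr0. Qed.
HB.instance Definition _ := GRing.isLinear.Build R[i] A U _ inA inA_is_linear.

Lemma inAM a b : inA (cmul a b) = inA a * inA b.
Proof. by rewrite mulUE/= mul0r !scale0r !add0r. Qed.

Lemma inAMr a S : inA (S.1 *: a + cmul S.2 a) = S * inA a.
Proof. by rewrite mulUE/= mulr0 !scale0r !addr0. Qed.

Lemma inAMl a S : inA (S.1 *: a + cmul a S.2) = inA a * S.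
Proof. by rewrite mulUE/= mul0r !scale0r !add0r. Qed.

Lemma inA_inj : injective inA.
Proof. by move=> a b []. Qed.

(** The exponent is a successor because [cpow a 0] is 0 whereas the 0-th power in
    the unitization is 1. *)
Lemma inA_cpow a n : inA (cpow a n.+1) = inA a ^+ n.+1.
Proof.
rewrite /cpow iteropS.
elim: n => [|n IH]; first by rewrite expr1.
by rewrite exprS -IH -inAM.
Qed.

Definition ustar S : U := (S.1^*, cstar S.2).

Lemma ustarK S : ustar (ustar S) = S.
Proof. by case: S => c a; rewrite /ustar/= conjcK cstarK. Qed.
Lemma ustarD S T : ustar (S + T) = ustar S + ustar T.
Proof. by congr pair; rewrite /= ?rmorphD// cstarD. Qed.
Lemma ustarZ c S : ustar (c *: S) = c^* *: ustar S.
Proof. by congr pair; rewrite /= ?rmorphM// cstarZ. Qed.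
Lemma ustarZr (r : R) S : ustar (r%:C *: S) = r%:C *: ustar S.
Proof. by rewrite ustarZ; congr (_ *: _); exact: conjc_real. Qed.
Lemma ustarM S T : ustar (S * T) = ustar T * ustar S.
Proof.
rewrite !mulUE/=; congr pair; rewrite /= ?rmorphM; first by rewrite mulrC.
by rewrite !cstarD !cstarZ cstarM (addrC (_ *: cstar T.2)).
Qed.
Lemma ustar0 : ustar 0 = 0.
Proof. by have := ustarZ 0 0; rewrite rmorph0 !scale0r. Qed.
Lemma ustar1 : ustar 1 = 1.
Proof. by have := ustarM 1 (ustar 1); rewrite mul1r ustarK mul1r. Qed.
Lemma ustarN S : ustar (- S) = - ustar S.
Proof. by rewrite -scaleN1r ustarZ rmorphN1 scaleN1r. Qed.
Lemma ustarB S T : ustar (S - T) = ustar S - ustar T.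
Proof. by rewrite ustarD ustarN. Qed.
Lemma ustarX S n : ustar (S ^+ n) = ustar S ^+ n.
Proof.
by elim: n => [|n IH]; rewrite ?expr0 ?ustar1// exprS ustarM IH -exprSr.
Qed.
Lemma ustar_inA a : ustar (inA a) = inA (cstar a).
Proof. by congr pair; exact: rmorph0. Qed.
Lemma ustar_sum (I : Type) (r : seq I) (P : pred I) (F : I -> U) :
  ustar (\sum_(i <- r | P i) F i) = \sum_(i <- r | P i) ustar (F i).
Proof. exact: (big_morph ustar ustarD ustar0). Qed.

Definition uact T v : A := T.1 *: v + cmul T.2 v.

Lemma uactM S T v : uact (S * T) v = uact S (uact T v).
Proof.
rewrite /uact/= !cmulDl !cmulDr !scalerDr !cmulZl !cmulZr !scalerA cmulA.
by rewrite -!addrA.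
Qed.

Lemma uactD S T v : uact (S + T) v = uact S v + uact T v.
Proof. by rewrite /uact/= scalerDl cmulDl addrACA. Qed.

Lemma uactZ c T v : uact (c *: T) v = c *: uact T v.
Proof. by rewrite /uact/= scalerDr cmulZl scalerA. Qed.

Lemma uactZr c T v : uact T (c *: v) = c *: uact T v.
Proof. by rewrite /uact/= scalerDr cmulZr !scalerA mulrC. Qed.

(** [uact T] and [uact (ustar T)] are adjoint for the [A]-valued inner product
    v^* w. *)
Lemma uact_star T v w : cmul (cstar (uact T v)) w = cmul (cstar v) (uact (ustar T) w).
Proof.
by rewrite /uact/= cstarD cstarZ cstarM cmulDl cmulDr cmulZl cmulZr cmulA.
Qed.

(** Norm of left multiplication by [T] on [A].  It is a seminorm only: if [A] has
    a unit 1_A, then 1 - 1_A acts as 0.  It extends the norm of [A]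
    ([opn_inA]) and satisfies the C*-identity ([opn_starM]). *)
Definition opn T : R := sup [set nm (uact T v) | v in [set v | nm v <= 1]].

Let opn_has_sup T : has_sup [set nm (uact T v) | v in [set v | nm v <= 1]].
Proof.
split; first by exists (nm (uact T 0)), 0 => //=; rewrite nm0.
exists (complex.Re `|T.1| + nm T.2) => _ [v /= v1 <-].
apply: le_trans (nmD _ _) _; rewrite nmZ.
have n0 := Re_norm_ge0 T.1.
apply: lerD; first by rewrite ler_piMr.
by apply: le_trans (nmM _ _) _; rewrite ler_piMr// nm_ge0.
Qed.

Lemma opn_ge0 T : 0 <= opn T.
Proof.
apply: le_trans (nm_ge0 (uact T 0)) _.
by apply: sup_upper_bound => //; exists 0 => //=; rewrite nm0.
Qed.

Lemma uact_le T v : nm (uact T v) <= opn T * nm v.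
Proof.
have [v0|v0] := eqVneq (nm v) 0.
  by rewrite (nm0_eq0 v0) /uact cmul0r scaler0 addr0 nm0 mulr0.
have vp : 0 < nm v by rewrite lt_def v0 nm_ge0.
rewrite -ler_pdivrMr//.
have -> : nm (uact T v) / nm v = nm (uact T (((nm v)^-1)%:C *: v)).
  by rewrite uactZr nmZr ger0_norm ?invr_ge0 ?nm_ge0// mulrC.
apply: sup_upper_bound => //; exists (((nm v)^-1)%:C *: v) => //=.
by rewrite nmZr ger0_norm ?invr_ge0 ?nm_ge0// mulVf.
Qed.

Lemma opn_le T M : 0 <= M -> (forall v, nm (uact T v) <= M * nm v) -> opn T <= M.
Proof.
move=> M0 TM; apply: ge_sup; first by have [] := opn_has_sup T.
by move=> _ [v /= v1 <-]; rewrite (le_trans (TM v))// ler_piMr.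
Qed.

Lemma opnD S T : opn (S + T) <= opn S + opn T.
Proof.
apply: opn_le => [|v]; first by rewrite addr_ge0 ?opn_ge0.
by rewrite uactD mulrDl (le_trans (nmD _ _))// lerD ?uact_le.
Qed.

Lemma opnM S T : opn (S * T) <= opn S * opn T.
Proof.
apply: opn_le => [|v]; first by rewrite mulr_ge0 ?opn_ge0.
by rewrite uactM -mulrA (le_trans (uact_le _ _))// ler_wpM2l ?opn_ge0 ?uact_le.
Qed.

Lemma opnZ_le c T : opn (c *: T) <= complex.Re `|c| * opn T.
Proof.
have n0 := Re_norm_ge0 c.
apply: opn_le => [|v]; first by rewrite mulr_ge0 ?opn_ge0.
by rewrite uactZ nmZ -mulrA ler_wpM2l ?uact_le.
Qed.

Lemma opn1 : opn 1 <= 1.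
Proof.
by apply: opn_le => // v; rewrite /uact/= scale1r cmul0l addr0 mul1r.
Qed.

Lemma opn0 : opn 0 = 0.
Proof.
apply/le_anti; rewrite opn_ge0 andbT; apply: opn_le => // v.
by rewrite /uact scale0r cmul0l addr0 nm0 mul0r.
Qed.

Lemma opnZ_real (r : R) T : 0 <= r -> opn (r%:C *: T) = r * opn T.
Proof.
move=> r0; apply/le_anti/andP; split.
  by apply: le_trans (opnZ_le _ _) _; rewrite Re_norm_real ger0_norm.
have [->|rn] := eqVneq r 0; first by rewrite mul0r opn_ge0.
have rp : 0 < r by rewrite lt_def rn.
rewrite -ler_pdivlMl//.
have {1}-> : T = (r^-1)%:C *: (r%:C *: T).
  by rewrite scalerA -rmorphM/= mulVf// scale1r.
by apply: le_trans (opnZ_le _ _) _; rewrite Re_norm_real ger0_norm ?invr_ge0.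
Qed.

Lemma opnN T : opn (- T) = opn T.
Proof.
have le S : opn (- S) <= opn S.
  rewrite -scaleN1r (le_trans (opnZ_le _ _))// normrN1 mul1r//.
by apply/le_anti; rewrite le/= -{1}(opprK T) le.
Qed.

(** The supremum is attained at v = a^*, by the C*-identity. *)
Lemma opn_inA a : opn (inA a) = nm a.
Proof.
apply/le_anti/andP; split.
  apply: opn_le => [|v]; rewrite ?nm_ge0// /uact/= scale0r add0r; exact: nmM.
have [->|a0] := eqVneq (nm a) 0; first exact: opn_ge0.
have ap : 0 < nm a by rewrite lt_def a0 nm_ge0.
rewrite -(ler_pM2r ap) -[X in _ <= _ * X]nm_cstar -expr2.
rewrite (le_trans _ (uact_le _ _))// /uact/= scale0r add0r.
by rewrite -{1}nm_cstar -nm_cstarM cstarK.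
Qed.

(** ||T v||^2 = ||v^* (T^* T v)|| <= ||v|| ||T^* T v||. *)
Let opn_sqr_le T : opn T ^+ 2 <= opn (ustar T * T).
Proof.
have n0 := opn_ge0 (ustar T * T).
rewrite -[leRHS]sqr_sqrtr// ler_sqr ?nnegrE ?opn_ge0 ?sqrtr_ge0//.
apply: opn_le => [|v]; first exact: sqrtr_ge0.
rewrite -ler_sqr ?nnegrE ?nm_ge0 ?mulr_ge0 ?sqrtr_ge0 ?nm_ge0//.
rewrite exprMn sqr_sqrtr// -nm_cstarM uact_star -uactM.
apply: le_trans (nmM _ _) _; rewrite nm_cstar expr2 mulrA (mulrC (opn _)).
by rewrite -mulrA ler_wpM2l ?nm_ge0 ?uact_le.
Qed.

Lemma opn_star T : opn (ustar T) = opn T.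
Proof.
have le S : opn S <= opn (ustar S).
  have [->|S0] := eqVneq (opn S) 0; first exact: opn_ge0.
  have Sp : 0 < opn S by rewrite lt_def S0 opn_ge0.
  by rewrite -(ler_pM2r Sp) -expr2 (le_trans (opn_sqr_le _))// opnM.
by apply/le_anti; rewrite le andbT -{2}(ustarK T) le.
Qed.

Lemma opn_starM T : opn (ustar T * T) = opn T ^+ 2.
Proof.
apply/le_anti; rewrite opn_sqr_le andbT (le_trans (opnM _ _))//.
by rewrite opn_star expr2.
Qed.

Lemma opn_Mstar T : opn (T * ustar T) = opn T ^+ 2.
Proof. by rewrite -{1}(ustarK T) opn_starM opn_star. Qed.

End Unitization.

(** * Square roots and unitary dilations *)

Section Complete.
Context (R : realType) (A : cstarAlgType R).
Implicit Types (x y : A).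

Lemma ball_nm x y (e : R) : ball x e%:C y <-> nm (x - y) < e.
Proof. by rewrite -ball_normE/= -nmE ltcR. Qed.

Lemma pos_complexP (e : R[i]) : 0 < e -> exists2 r : R, 0 < r & e = r%:C.
Proof.
move=> e0; exists (complex.Re e).
  by move: e0; rewrite ltcE => /andP[].
by rewrite RRe_real// gtr0_real.
Qed.

Lemma nm_complete (u : nat -> A) :
  (forall e, 0 < e -> exists n0, forall m n, (n0 <= m)%N -> (n0 <= n)%N ->
     nm (u m - u n) <= e) ->
  exists l, forall e, 0 < e -> exists n0, forall n, (n0 <= n)%N ->
     nm (u n - l) <= e.
Proof.
move=> u_cauchy.
have /cauchy_cvgP/cvg_ex[l ul] : cauchy (u @ \oo).
  apply: cauchy_exP => _ /pos_complexP[e e0 ->].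
  have [n0 n0P] := u_cauchy (e / 2) ltac:(lra).
  exists (u n0); exists n0 => // n /= n0n.
  by apply/ball_nm; rewrite (le_lt_trans (n0P _ _ _ _))//; lra.
exists l => e e0.
have : \forall n \near \oo, ball l e%:C (u n).
  by move/cvg_ballP : ul; apply; rewrite ltcR.
move=> [n0 _ n0P]; exists n0 => n n0n.
by rewrite -nmN opprB ltW//; apply/ball_nm/n0P.
Qed.

End Complete.

Section SquareRoot.
Context (R : realType) (A : cstarAlgType R).
Implicit Types (a x y : A).

(** The limit y of this iteration solves y = (a + y^2) / 2, that is
    (1 - y)^2 = 1 - a. *)
Fixpoint sqrt_seq a n : A :=
  if n is m.+1 then (2^-1)%:C *: (a + cmul (sqrt_seq a m) (sqrt_seq a m)) else 0.

(** The same iteration for the number 1 in place of [a].  It dominates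
    [sqrt_seq], term by term and for the increments. *)
Fixpoint majorant n : R :=
  if n is m.+1 then 2^-1 * (1 + majorant m ^+ 2) else 0.

Lemma majorant_bounds n : 0 <= majorant n <= 1.
Proof. by elim: n => [|n IH] /=; [lra|nra]. Qed.

Lemma majorantS n : majorant n <= majorant n.+1.
Proof. by have := majorant_bounds n; simpl; nra. Qed.

Lemma majorant_mono : {homo majorant : m n / (m <= n)%N >-> m <= n}.
Proof. exact: homo_leq le_refl le_trans majorantS. Qed.

Lemma majorant_cauchy e : 0 < e -> exists n0, forall m, (n0 <= m)%N ->
  majorant m - majorant n0 <= e.
Proof.
move=> e0.
have ub : has_sup (range majorant).
  split; first by exists (majorant 0), 0%N.
  by exists 1 => _ [n _ <-]; have /andP[] := majorant_bounds n.
have [_ [n0 _ <-] n0P] := sup_adherent e0 ub.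
exists n0 => m _; have : majorant m <= sup (range majorant).
  by apply: sup_upper_bound => //; exists m.
lra.
Qed.

Context (a : A) (a1 : nm a <= 1).

Let y := sqrt_seq a.

(** All iterates are polynomials in [a]. *)
Lemma sqrt_seq_comm b : cmul a b = cmul b a ->
  forall n, cmul (y n) b = cmul b (y n).
Proof.
move=> ab; elim=> [|n IH] /=; first by rewrite cmul0l cmul0r.
rewrite /y/= cmulZl cmulZr cmulDl cmulDr ab -!/(y n).
by rewrite -cmulA IH cmulA IH cmulA.
Qed.

Lemma sqrt_seq_star : cstar a = a -> forall n, cstar (y n) = y n.
Proof.
move=> sa; elim=> [|n IH] /=.
  by have := @cstarZ _ A 0 0; rewrite rmorph0 !scale0r.
rewrite /y/= cstarZ cstarD cstarM sa -!/(y n) IH.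
congr (_ *: _). exact: conjc_real.
Qed.

Lemma sqrt_seq_nm n : nm (y n) <= majorant n.
Proof.
elim: n => [|n IH]; first by rewrite nm0.
rewrite /y/= nmZr ger0_norm ?invr_ge0// ler_wpM2l ?invr_ge0//.
apply: le_trans (nmD _ _) _; apply: lerD => //.
by apply: le_trans (nmM _ _) _; rewrite -/(y n); have := nm_ge0 (y n); nra.
Qed.

Lemma cmul_sqr_diff b y1 y0 : cmul y1 y0 = cmul y0 y1 ->
  (b + cmul y1 y1) - (b + cmul y0 y0) = cmul (y1 + y0) (y1 - y0).
Proof.
move=> /(congr1 (@inA _ A)); rewrite !inAM => yyU.
apply: (@inA_inj _ A); rewrite !(raddfB, raddfD)/= !inAM !(raddfB, raddfD)/=.
by rewrite mulrDl !mulrBr yyU; ncring.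
Qed.

Lemma sqrt_seq_diff n : nm (y n.+1 - y n) <= majorant n.+1 - majorant n.
Proof.
elim: n => [|n IH].
  rewrite /y/= subr0 cmul0l addr0 nmZr ger0_norm ?invr_ge0//.
  have := a1; nra.
have -> : y n.+2 - y n.+1 = (2^-1)%:C *: cmul (y n.+1 + y n) (y n.+1 - y n).
  have yS m : y m.+1 = (2^-1)%:C *: (a + cmul (y m) (y m)) by [].
  have yy : cmul (y n.+1) (y n) = cmul (y n) (y n.+1).
    by apply: sqrt_seq_comm; apply/esym/sqrt_seq_comm.
  rewrite (yS n.+1) {2}(yS n) -scalerBr; congr (_ *: _).
  exact: cmul_sqr_diff.
rewrite nmZr ger0_norm ?invr_ge0//.
apply: le_trans (ler_wpM2l _ (nmM _ _)) _; first lra.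
have := sqrt_seq_nm n.+1; have := sqrt_seq_nm n; have := nmD (y n.+1) (y n).
have := nm_ge0 (y n.+1 - y n); have := nm_ge0 (y n.+1 + y n).
have := majorant_bounds n.+1; have := majorant_bounds n.
rewrite [majorant n.+2]/=.
set p := nm _; set q := nm _; set r := nm _; set t := nm _.
move: IH; rewrite -/q; set m1 := majorant n.+1; set m0 := majorant n.
move=> qle m0b m1b p0 q0 ple rle tle.
have ->: 2^-1 * (1 + m1 ^+ 2) - m1 = 2^-1 * ((m1 + m0) * (m1 - m0)).
  by rewrite (_ : m1 = 2^-1 * (1 + m0 ^+ 2)) //; field.
rewrite ler_wpM2l ?invr_ge0// ler_pM//; lra.
Qed.

Lemma sqrt_seq_dist m n : (n <= m)%N ->
  nm (y m - y n) <= majorant m - majorant n.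
Proof.
move=> /subnK <-; elim: (m - n)%N => [|k IH].
  by rewrite add0n !subrr nm0.
rewrite addSn -(subrK (y (k + n)) (y (k + n).+1)) -addrA.
apply: le_trans (nmD _ _) _; have := sqrt_seq_diff (k + n); lra.
Qed.

End SquareRoot.

(** For estimates proved up to a multiple of an arbitrarily small error. *)
Lemma le0_small (R : realType) (x C : R) :
  (forall e, 0 < e -> x <= C * e) -> x <= 0.
Proof.
move=> xC; rewrite leNgt; apply/negP => x0.
have d0 : 0 < `|C| + 1 by rewrite ltr_wpDl.
have := xC (x / (`|C| + 1) / 2); rewrite !divr_gt0// => /(_ isT).
apply/negP; rewrite -ltNge (@le_lt_trans _ _ (`|C| * (x / (`|C| + 1) / 2)))//.
  by rewrite ler_wpM2r ?ler_norm// !divr_ge0// ltW.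
rewrite -!mulrA mulrCA -[ltRHS]mulr1 ltr_pM2l// mulrA.
rewrite ltr_pdivrMr// mul1r ltr_pdivrMr//.
have := normr_ge0 C; lra.
Qed.

Section SquareRootLimit.
Context (R : realType) (A : cstarAlgType R).
Implicit Types (h x y : A).
Local Notation U := (unitization A).

Lemma nm_le0 x : nm x <= 0 -> x = 0.
Proof. by move=> x0; apply: nm0_eq0; apply/le_anti; rewrite x0 nm_ge0. Qed.

Lemma fixpoint_defect (b l y0 y1 : A) : y1 + y1 = b + cmul y0 y0 ->
  l + l - cmul l l - b = (cmul (y0 - l) l + cmul y0 (y0 - l))
    - ((y1 - l) + (y1 - l)).
Proof.
move=> /esym/(canRL (addrK _)) ->; apply: (@inA_inj _ A).
by rewrite !(raddfB, raddfD)/= !inAM !(raddfB, raddfD)/=; ncring.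
Qed.

(** The square root of 1 - h^2 has the form 1 - y with y in [A], so it can be
    taken as a limit in the complete space [A], on which [opn] is a norm. *)
Lemma sqrt_sub_sqr h : cstar h = h -> nm h <= 1 ->
  exists2 y : A, cstar y = y & cmul y h = cmul h y /\
    (1 - inA y) * (1 - inA y) = 1 - inA h * inA h :> U.
Proof.
move=> sh h1; pose a := cmul h h.
have a1 : nm a <= 1.
  by apply: le_trans (nmM _ _) _; have := nm_ge0 h; nra.
pose y := sqrt_seq a.
have sa : cstar a = a by rewrite cstarM sh.
have [|l lP] := @nm_complete _ _ y.
  move=> e e0; have [n0 n0P] := majorant_cauchy e0.
  have half : forall m n, (n0 <= n)%N -> (n <= m)%N -> nm (y m - y n) <= e.
    move=> m n n0n nm; apply: le_trans (sqrt_seq_dist a1 nm) _.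
    have := n0P m (leq_trans n0n nm); have := majorant_mono R n0n; lra.
  exists n0 => m n n0m n0n; have [nm|mn] := leqP n m; first exact: half.
  by rewrite -nmN opprB half// ltnW.
have yhC n : cmul (y n) h = cmul h (y n).
  by apply: sqrt_seq_comm; rewrite /a cmulA.
have lim_nm (z : A) (C : R) : (forall e, 0 < e -> forall n, nm (y n - l) <= e ->
    nm (y n.+1 - l) <= e -> nm z <= C * e) -> z = 0.
  move=> zC. apply: nm_le0; apply: (@le0_small _ _ C) => e e0.
  have [n0 n0P] := lP _ e0.
  by apply: (zC _ e0 n0); apply: n0P.
exists l; last split.
- apply/eqP; rewrite -subr_eq0; apply/eqP.
  apply: (lim_nm _ 2) => e e0 n yl _.
  have -> : cstar l - l = (y n - l) - cstar (y n - l).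
    apply: (@inA_inj _ A).
    by rewrite cstarB (sqrt_seq_star sa) !raddfB/=; ncring.
  apply: le_trans (nmD _ _) _; rewrite nmN nm_cstar; lra.
- apply/eqP; rewrite -subr_eq0; apply/eqP.
  apply: (lim_nm _ (2 * nm h)) => e e0 n yl _.
  have -> : cmul l h - cmul h l = cmul h (y n - l) - cmul (y n - l) h.
    apply: (@inA_inj _ A); rewrite !raddfB/= !inAM !raddfB/=.
    by have := congr1 (@inA _ A) (yhC n); rewrite !inAM => E; rewrite !mulrBl !mulrBr E; ncring.
  apply: le_trans (nmD _ _) _; rewrite nmN.
  have := nmM h (y n - l); have := nmM (y n - l) h.
  by have := nm_ge0 h; nra.
have l1 : nm l <= 2.
  have [n0 n0P] := lP _ ltr01; have := n0P _ (leqnn _).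
  have := sqrt_seq_nm a1 n0; have /andP[_] := majorant_bounds R n0.
  have := nmD (l - y n0) (y n0).
  by rewrite subrK -[nm (l - _)]nmN opprB -/y; lra.
suff E : l + l - cmul l l - a = 0.
  have := congr1 (@inA _ A) E.
  rewrite !raddfB raddfD raddf0/= !inAM => /subr0_eq <-; ncring.
apply: (lim_nm _ 5) => e e0 n yl yl1.
have -> : l + l - cmul l l - a = (cmul (y n - l) l + cmul (y n) (y n - l))
    - ((y n.+1 - l) + (y n.+1 - l)).
  have yy : y n.+1 + y n.+1 = a + cmul (y n) (y n).
    rewrite /y /= -/y -scalerDl -rmorphD/= -[RHS]scale1r.
    by congr (_ *: _); rewrite -[RHS](rmorph1 (real_complex R)); congr (_%:C); field.
  exact: fixpoint_defect.
have : nm (y n - l) * nm l <= e * 2 by rewrite ler_pM ?nm_ge0.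
have : nm (y n) * nm (y n - l) <= 1 * e.
  have := sqrt_seq_nm a1 n; have /andP[_] := majorant_bounds R n; rewrite -/y.
  by move=> r1 yr; rewrite ler_pM ?nm_ge0//; lra.
have := nmM (y n - l) l; have := nmM (y n) (y n - l).
have := nmD (cmul (y n - l) l) (cmul (y n) (y n - l)).
have := nmD (cmul (y n - l) l + cmul (y n) (y n - l)) (- ((y n.+1 - l) + (y n.+1 - l))).
have := nmD (y n.+1 - l) (y n.+1 - l); rewrite nmN.
lra.
Qed.

End SquareRootLimit.

Section Unitary.
Context (R : realType) (A : cstarAlgType R).
Local Notation U := (unitization A).

(** u = h + i sqrt (1 - h^2) is unitary and h is its real part. *)
Lemma unitary_dilation (h : A) : cstar h = h -> nm h <= 1 ->
  exists u v : U, [/\ u * v = 1, v * u = 1, opn u <= 1, opn v <= 1 &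
                      inA h *+ 2 = u + v].
Proof.
move=> sh h1; have [y sy [yh yE]] := sqrt_sub_sqr sh h1.
pose I : R[i] := 'i%C; pose H : U := inA h; pose S : U := 1 - inA y.
have HS : H * S = S * H.
  by rewrite /H /S mulrBr mulrBl mulr1 mul1r -!inAM yh.
have II : I * I = -1 by rewrite -expr2 sqr_i.
have uv : (H + I *: S) * (H - I *: S) = 1.
  rewrite mulrDl !mulrBr -!scalerAr -!scalerAl HS scalerA II scaleN1r yE.
  by rewrite opprK -/H; ncring.
have vu : (H - I *: S) * (H + I *: S) = 1.
  rewrite mulrBl !mulrDr -!scalerAr -!scalerAl HS scalerA II scaleN1r yE.
  by rewrite -/H; ncring.
have su : ustar (H + I *: S) = H - I *: S.
  rewrite ustarD ustarZ /H /S ustarB ustar1 !ustar_inA sh sy -scaleNr.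
  by congr (_ + _ *: _); rewrite /I; apply/eqP; rewrite eq_complex/= oppr0 !eqxx.
have contr T : ustar T * T = 1 -> opn T <= 1.
  move=> T1; have : opn T ^+ 2 <= 1 by rewrite -opn_starM T1 opn1.
  by rewrite expr_le1// opn_ge0.
exists (H + I *: S), (H - I *: S); split => //.
- by apply: contr; rewrite su.
- by apply: contr; rewrite -su ustarK su.
- by rewrite -/H; ncring.
Qed.

End Unitary.

(** * Polynomials in a self-adjoint contraction *)

Section Coefficients.
Context (R : realType).
Implicit Types (S : {poly R[i]}).

Lemma prim_root_exists n : (0 < n)%N -> exists z : R[i], n.-primitive_root z.
Proof.
pose p : {poly R[i]} := 'X^n - 1; have [r Dp] := closed_field_poly_normal p.
move=> n_gt0; rewrite (monicP _) ?monicXnsubC // scale1r in Dp.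
have rn1: all n.-unity_root r by apply/allP=> z; rewrite -root_prod_XsubC -Dp.
have sz_r: (n < (size r).+1)%N.
  by rewrite -(size_prod_XsubC r id) -Dp size_XnsubC.
have [|z] := hasP (has_prim_root n_gt0 rn1 _ sz_r); last by exists z.
by rewrite -separable_prod_XsubC -Dp separable_Xn_sub_1 // pnatr_eq0 -lt0n.
Qed.

Lemma sum_unity_root n (w : R[i]) : w ^+ n = 1 -> w != 1 ->
  \sum_(k < n) w ^+ k = 0.
Proof.
move=> wn w1; have := subrX1 w n; rewrite wn subrr => /esym/eqP.
by rewrite mulf_eq0 subr_eq0 (negPf w1) => /eqP.
Qed.

(** A coefficient is a Fourier coefficient of the restriction to the n-th roots
    of unity: n S_i is the sum of z^(-ik) S(z^k) over k < n, z primitive. *)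
Lemma coef_le_max S n (M : R) :
  (size S <= n)%N ->
  (forall w : R[i], `|w| = 1 -> complex.Re `|S.[w]| <= M) ->
  forall i, complex.Re `|S`_i| <= M.
Proof.
move=> Sn SM i.
have M0 : 0 <= M by apply: le_trans (SM 1 _); rewrite ?Re_norm_ge0 ?normr1.
have [ni|i_n] := leqP n i.
  by rewrite nth_default ?normr0// (leq_trans Sn).
have n0 : (0 < n)%N by case: n i_n {Sn}.
have [z zn] := prim_root_exists n0.
have z1 : `|z| = 1.
  apply/eqP; rewrite -(@pexpr_eq1 _ _ n)// -normrX.
  by rewrite (prim_expr_order zn) normr1.
have key : n%:R * S`_i = \sum_(k < n) z ^+ ((n - i) * k) * S.[z ^+ k].
  under eq_bigr => k _ do rewrite (horner_coef_wide _ Sn) mulr_sumr.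
  rewrite exchange_big/= (bigD1 (Ordinal i_n))//= [X in _ + X]big1 => [|j ji].
    rewrite addr0; under eq_bigr => k _.
      rewrite mulrCA -exprM -exprD (mulnC k) -mulnDl subnK 1?ltnW// exprM.
      rewrite (prim_expr_order zn) expr1n mulr1; over.
    by rewrite sumr_const card_ord mulr_natl.
  under eq_bigr => k _.
    rewrite mulrCA -exprM -exprD (mulnC k) -mulnDl exprM; over.
  rewrite -mulr_sumr sum_unity_root ?mulr0//.
    by rewrite -exprM mulnC exprM (prim_expr_order zn) expr1n.
  rewrite -(expr0 z) (eq_prim_root_expr zn).
  apply: contra ji => /eqP; rewrite mod0n => e; apply/eqP/val_inj => /=.
  have jn := ltn_ord j.
  have : (n %| n - i + j)%N by rewrite /dvdn e.
  have [ij|ij] := ltnP i j.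
    rewrite addnBAC ?(ltnW i_n)// -addnBA ?(ltnW ij)// dvdn_addr// gtnNdvd//.
    - by rewrite subn_gt0.
    - by rewrite (leq_ltn_trans _ jn)// leq_subr.
  move=> d; apply/eqP; rewrite eqn_leq ij/= leqNgt; apply/negP => ji'.
  move: d; rewrite gtnNdvd//.
    by rewrite addn_gt0 subn_gt0 i_n.
  by rewrite addnC addnBA ?(ltnW i_n)// ltn_subLR ?ltn_add2r// (leq_trans (ltnW i_n))// leq_addl.
have : complex.Re `|n%:R * S`_i| <= n%:R * M.
  rewrite key -lecR RRe_real//.
  apply: le_trans (ler_norm_sum _ _ _) _.
  rewrite rmorphM rmorph_nat -[n in n%:R]card_ord -sumr_const mulr_suml.
  rewrite ler_sum// => k _; rewrite normrM normrX z1 expr1n !mul1r.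
  by rewrite -[leLHS]RRe_real// lecR SM// normrX z1 expr1n.
rewrite normrM -lecR RRe_real ?realM// rmorphM rmorph_nat normr_nat.
by rewrite ler_pM2l ?ltr0n// -[leLHS]RRe_real// lecR.
Qed.

End Coefficients.

Section PolyEval.
Context (R : realType) (A : cstarAlgType R).
Local Notation U := (unitization A).
Implicit Types (p q : {poly R}) (S : {poly R[i]}) (T u v H : U).

Definition pev p T : U := horner_alg T (map_poly (real_complex R) p).

Lemma pevB p q T : pev (p - q) T = pev p T - pev q T.
Proof. by rewrite /pev !rmorphB. Qed.
Lemma pevM p q T : pev (p * q) T = pev p T * pev q T.
Proof. by rewrite /pev !rmorphM. Qed.
Lemma pevXn p n T : pev (p ^+ n) T = pev p T ^+ n.
Proof. by rewrite /pev !rmorphXn. Qed.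
Lemma pev1 T : pev 1 T = 1.
Proof. by rewrite /pev !rmorph1. Qed.
Lemma pevX T : pev 'X T = T.
Proof. by rewrite /pev map_polyX horner_algX. Qed.
Lemma horner_algE T S n : (size S <= n)%N ->
  horner_alg T S = \sum_(i < n) S`_i *: T ^+ i.
Proof.
move=> Sn; rewrite -[S in LHS](coefK S) poly_def linear_sum/=.
under eq_bigr => i _ do rewrite linearZ/= rmorphXn/= horner_algX mulr_algl.
rewrite (big_ord_widen n (fun i => S`_i *: T ^+ i) Sn) big_mkcond/=.
apply: eq_bigr => i _; case: ltnP => // iS.
by rewrite nth_default// scale0r.
Qed.

Lemma pevE T p n : (size p <= n)%N ->
  pev p T = \sum_(i < n) (p`_i)%:C *: T ^+ i.
Proof.
move=> pn; rewrite /pev (@horner_algE _ _ n).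
  by apply: eq_bigr => i _; rewrite coef_map.
by rewrite size_map_poly.
Qed.

Lemma ustar_pev T p : ustar T = T -> ustar (pev p T) = pev p T.
Proof.
move=> sT; rewrite (pevE _ (leqnn _)) ustar_sum; apply: eq_bigr => i _.
by rewrite ustarZr ustarX sT.
Qed.

Lemma opnX_bound T (c : R) n : opn T <= c -> opn (T ^+ n) <= c ^+ n.
Proof.
move=> Tc; elim: n => [|n IH]; first exact: opn1.
rewrite exprS [leRHS]exprS; apply: le_trans (opnM _ _) _.
by apply: ler_pM; rewrite ?opn_ge0.
Qed.

Lemma opnX_le T n : opn T <= 1 -> opn (T ^+ n) <= 1.
Proof. by move=> /(opnX_bound n); rewrite expr1n. Qed.

Lemma opn_sum (I : Type) (r : seq I) (P : pred I) (F : I -> U) :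
  opn (\sum_(i <- r | P i) F i) <= \sum_(i <- r | P i) opn (F i).
Proof.
elim/big_ind2: _ => [|x1 x2 y1 y2 h1 h2|//]; first by rewrite opn0.
by rewrite (le_trans (opnD _ _))// lerD.
Qed.

(** u^2 + 1 = u (u + u^-1): this turns polynomials in u + u^-1 into polynomials
    in u, up to a power of u. *)
Lemma laurent_identity (B : nzRingType) (u v : B) d i :
  u * v = 1 -> v * u = 1 -> (i <= d)%N ->
  u ^+ (d - i) * (u ^+ 2 + 1) ^+ i = u ^+ d * (u + v) ^+ i.
Proof.
move=> uv vu id; have -> : u ^+ 2 + 1 = u * (u + v) by rewrite mulrDr uv expr2.
rewrite exprMn_comm; last by rewrite /GRing.comm mulrDr mulrDl uv vu.
by rewrite mulrA -exprD subnK.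
Qed.

(** The polynomial z^d p((z + 1/z) / 2) with d = size p. *)
Definition cosine_lift p : {poly R[i]} :=
  \sum_(i < size p) (p`_i / 2 ^+ i)%:C *:
     ('X^(size p - i) * ('X^2 + 1) ^+ i).

Lemma size_cosine_lift p : (size (cosine_lift p) <= (size p).*2.+1)%N.
Proof.
apply: leq_trans (size_sum _ _ _) _; apply/bigmax_leqP => i _.
apply: leq_trans (size_scale_leq _ _) _; apply: leq_trans (size_polyMleq _ _) _.
rewrite size_polyXn addSn/=.
have : (size (('X^2 + 1 : {poly R[i]}) ^+ i) <= i.*2.+1)%N.
  apply: leq_trans (size_poly_exp_leq _ _) _.
  by rewrite -(polyC1 R[i]) size_XnaddC// mul2n.
have := ltn_ord i; set s := seq.size p; set t := seq.size _.
by move: (nat_of_ord i) => k; clearbody s t; lia.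
Qed.

Lemma cosine_liftE u v H p : u * v = 1 -> v * u = 1 -> H *+ 2 = u + v ->
  horner_alg u (cosine_lift p) = u ^+ size p * pev p H.
Proof.
move=> uv vu Huv; rewrite (pevE _ (leqnn _)) mulr_sumr linear_sum/=.
apply: eq_bigr => i _; set c := (p`_i / _)%:C.
rewrite linearZ/= mulr_algl rmorphM/= !rmorphXn/= rmorphD/=.
rewrite rmorph1 rmorphXn/= !horner_algX (laurent_identity uv vu (ltnW (ltn_ord i))).
rewrite {}/c -Huv -[RHS]scalerAr [(H *+ 2) ^+ i]exprMn_n mulrnAr -(scaler_nat (2 ^ i) (_ * _)) scalerA.
congr (_ *: _); rewrite -(rmorph_nat (real_complex R)) -rmorphM/=.
by rewrite natrX divfK// expf_neq0.
Qed.

Lemma cosine_lift_unit (w : R[i]) p : `|w| = 1 ->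
  (cosine_lift p).[w] = w ^+ size p * (p.[complex.Re w])%:C.
Proof.
move=> w1; have ww : w * w^*%C = 1 by rewrite -sqr_normc w1 expr1n.
rewrite horner_sum (_ : _%:C = \sum_(i < size p) (p`_i)%:C * ((complex.Re w)%:C) ^+ i); last first.
  rewrite horner_coef rmorph_sum/=; apply: eq_bigr => i _.
  by rewrite rmorphM rmorphXn.
rewrite mulr_sumr; apply: eq_bigr => i _; rewrite hornerZ hornerM !horner_exp hornerD -polyC1 hornerC horner_exp !hornerX.
have ww' : w^*%C * w = 1 by rewrite mulrC.
rewrite (laurent_identity ww ww' (ltnW (ltn_ord i))).
have -> : w + w^*%C = (complex.Re w)%:C * 2%:R.
  by rewrite [X in X * _]ReJ_add divfK.
rewrite exprMn mulrCA; congr (_ * _); rewrite mulrCA mulrC; congr (_ * _).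
have -> : (2 : R[i]) ^+ i = (2 ^+ i)%:C by rewrite rmorphXn/= rmorph_nat.
by rewrite -rmorphM/= divfK// expf_neq0.
Qed.

End PolyEval.

Section SupBound.
Context (R : realType) (A : cstarAlgType R).
Local Notation U := (unitization A).

(** By the C*-identity; exponents that are powers of 2 are the ones obtained by
    squaring repeatedly. *)
Lemma opn_sa_X2 (T : U) j : ustar T = T -> opn (T ^+ (2 ^ j)) = opn T ^+ (2 ^ j).
Proof.
move=> sT; elim: j => [|j IH]; first by rewrite !expr1.
by rewrite expnSr !exprM -IH -opn_starM ustarX sT expr2.
Qed.

(** If X > M, then (X/M)^(2^j) grows faster than any multiple of 2^j. *)
Lemma le_of_power_growth (X M a b : R) : 0 < M -> 0 <= X -> 0 <= a -> 0 <= b ->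
  (forall j, X ^+ (2 ^ j) <= (a * (2 ^ j)%:R + b) * M ^+ (2 ^ j)) -> X <= M.
Proof.
move=> M0 X0 a0 b0 H; rewrite leNgt; apply/negP => MX.
pose d := X / M - 1.
have d0 : 0 < d by rewrite subr_gt0 ltr_pdivlMr// mul1r.
have XE : X = M * (1 + d) by rewrite /d addrC subrK mulrC divfK// gt_eqF.
have bern m : 1 + d *+ m <= (1 + d) ^+ m.
  elim: m => [|m IH]; first by rewrite mulr0n addr0 expr0.
  rewrite exprS mulrS; have : 0 <= d *+ m by rewrite mulrn_wge0// ltW.
  by move: IH; set z := d *+ m; set w := _ ^+ m; nra.
have [n nP] : exists n : nat, (a * 2 + b) / d ^+ 2 < n%:R.
  by exists (Num.bound ((a * 2 + b) / d ^+ 2)); rewrite archi_boundP// divr_ge0 ?sqr_ge0; lra.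
have := H n.+1; rewrite XE exprMn mulrC ler_pM2r ?exprn_gt0//.
apply/negP; rewrite -ltNge expnSr exprM.
have n2 : (n%:R : R) < (2 ^ n)%:R by rewrite ltr_nat ltn_expl.
have t1 : (1 : R) <= (2 ^ n)%:R by rewrite ler1n expn_gt0.
have := bern (2 ^ n)%N; rewrite -mulr_natr natrM.
move: nP; rewrite ltr_pdivrMr ?exprn_gt0//.
set t : R := (2 ^ n)%:R; set w := (1 + d) ^+ (2 ^ n)%N; rewrite -/t in n2 t1 *.
move=> nP bw; have dt : 0 <= d * t by apply: mulr_ge0; lra.
have w2 : (d * t) ^+ 2 <= w ^+ 2 by rewrite ler_sqr ?nnegrE; lra.
apply: lt_le_trans w2; rewrite exprMn.
have : (a * 2 + b) * t < d ^+ 2 * t ^+ 2.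
  rewrite [t ^+ 2]expr2 mulrA ltr_pM2r ?(lt_le_trans _ t1)//.
  by apply: lt_trans nP _; rewrite mulrC ltr_pM2l ?exprn_gt0.
nra.
Qed.

(** For a unitary u the norm of S(u) is at most the sum of the moduli of the
    coefficients of S, each of which is bounded by the values of S on the
    circle.  The factor 2 (size p) + 1 counts these coefficients. *)
Lemma opn_pev_weak (h : A) (p : {poly R}) (M : R) : cstar h = h -> nm h <= 1 ->
  (forall t : R, -1 <= t <= 1 -> `|p.[t]| <= M) ->
  opn (pev p (inA h)) <= (2 * (size p)%:R + 1) * M.
Proof.
move=> sh h1 pM; have [u [v [uv vu u1 v1 huv]]] := unitary_dilation sh h1.
have M0 : 0 <= M by rewrite (le_trans (normr_ge0 _) (pM 0 _))//; lra.
pose P := cosine_lift p.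
have -> : pev p (inA h) = v ^+ size p * horner_alg u P.
  rewrite (cosine_liftE p uv vu huv) mulrA -exprMn_comm ?vu ?expr1n ?mul1r//.
  by rewrite /GRing.comm uv.
apply: le_trans (opnM _ _) _.
apply: (@le_trans _ _ (opn (horner_alg u P))).
  by rewrite ler_piMl ?opn_ge0 ?opnX_le.
rewrite (horner_algE _ (size_cosine_lift p)).
apply: le_trans (opn_sum _ _ _) _.
apply: (@le_trans _ _ (\sum_(i < (size p).*2.+1) M)); last first.
  rewrite sumr_const card_ord -[M *+ _]mulr_natl -(addn1 (size p).*2) natrD -mul2n natrM.
  exact: lexx.
apply: ler_sum => i _; apply: le_trans (opnZ_le _ _) _.
apply: (@le_trans _ _ (complex.Re `|P`_i|)).
  by rewrite ler_piMr ?Re_norm_ge0 ?opnX_le.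
apply: (coef_le_max (size_cosine_lift p)) => w w1.
rewrite cosine_lift_unit// normrM normrX w1 expr1n mul1r Re_norm_real pM//.
by rewrite -ler_norml -lecR -[X in _ <= X]w1 normc_ge_Re.
Qed.

(** The factor lost in [opn_pev_weak] grows only linearly with the degree, so it
    disappears when the estimate is applied to the powers p^(2^j) and the
    2^j-th root is taken. *)
Lemma opn_pev (h : A) (p : {poly R}) (M : R) : cstar h = h -> nm h <= 1 ->
  (forall t : R, -1 <= t <= 1 -> `|p.[t]| <= M) -> opn (pev p (inA h)) <= M.
Proof.
move=> sh h1 pM.
have M0 : 0 <= M by rewrite (le_trans (normr_ge0 _) (pM 0 _))//; lra.
apply/ler_addgt0Pl => e e0.
apply: (@le_of_power_growth _ _ (2 * (size p)%:R) 3).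
- lra.
- exact: opn_ge0.
- by rewrite mulr_ge0.
- lra.
move=> j; have sT : ustar (pev p (inA h)) = pev p (inA h).
  by rewrite ustar_pev// ustar_inA sh.
rewrite -opn_sa_X2// -pevXn.
apply: le_trans (@opn_pev_weak h _ ((e + M) ^+ (2 ^ j)) sh h1 _) _ => [t t1|].
  rewrite horner_exp normrX; have := pM _ t1; have := normr_ge0 p.[t] => n0 nM.
  by apply: lerXn2r; rewrite ?nnegrE; lra.
rewrite ler_wpM2r ?exprn_ge0//; first lra.
have : (size (p ^+ (2 ^ j)) <= size p * 2 ^ j + 1)%N.
  by apply: leq_trans (size_poly_exp_leq _ _) _; rewrite addn1 ltnS leq_mul2r leq_pred orbT.
by rewrite -(ler_nat R) natrD natrM; lra.
Qed.

End SupBound.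

(** * Approximate units *)

Section Ideal.
Context (R : realType) (A : cstarAlgType R) (I : ideal A).
Local Notation U := (unitization A).
Implicit Types (S T e g a : U).

(** The image of [I] is an ideal of the unitization. *)
Definition inI T := exists2 a, ideal_set I a & T = inA a.

Lemma inI0 : inI 0.
Proof. by exists 0; rewrite ?raddf0//; exact: ideal0. Qed.
Lemma inID S T : inI S -> inI T -> inI (S + T).
Proof. by move=> [a Ia ->] [b Ib ->]; exists (a + b); rewrite ?raddfD//; exact: idealD. Qed.
Lemma inIZ c T : inI T -> inI (c *: T).
Proof. by move=> [a Ia ->]; exists (c *: a); rewrite ?linearZ//; exact: idealZ. Qed.
Lemma inIN T : inI T -> inI (- T).
Proof. by rewrite -scaleN1r; exact: inIZ. Qed.
Lemma inIB S T : inI S -> inI T -> inI (S - T).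
Proof. by move=> IS /inIN; exact: inID. Qed.
Lemma inIMl S T : inI T -> inI (S * T).
Proof.
move=> [a Ia ->]; rewrite -inAMr; eexists; last by [].
by apply: idealD; [exact: idealZ|exact: Defs.idealMl].
Qed.
Lemma inIMr S T : inI T -> inI (T * S).
Proof.
move=> [a Ia ->]; rewrite -inAMl; eexists; last by [].
by apply: idealD; [exact: idealZ|exact: Defs.idealMr].
Qed.
Lemma inI_sum (J : Type) (r : seq J) (P : pred J) (F : J -> U) :
  (forall i, P i -> inI (F i)) -> inI (\sum_(i <- r | P i) F i).
Proof. by move=> h; elim/big_ind: _ => //; [exact: inI0|exact: inID]. Qed.

(** Elements of [I] playing the role of positive contractions.  The bound on
    1 - e is the one that survives long products; [e] itself has norm at most 2
    ([cutoff_le2]). *)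
Record cutoff e : Prop := Cutoff {
  cutoff_ideal : inI e;
  cutoff_star : ustar e = e;
  cutoff_compl : opn (1 - e) <= 1
}.

Lemma cutoff_le2 e : cutoff e -> opn e <= 2.
Proof.
move=> [_ _ e1]; have -> : e = 1 - (1 - e) by ncring.
apply: le_trans (opnD _ _) _; rewrite opnN; have := opn1 A; lra.
Qed.

Lemma bernoulli_inv (y : R) n : 0 <= y <= 1 -> (1 - y) ^+ n * (1 + n%:R * y) <= 1.
Proof.
move=> y01; elim: n => [|n IH]; first by rewrite expr0 mul0r addr0 mulr1.
rewrite exprS -natr1; have n0 : 0 <= n%:R :> R by [].
have w0 : 0 <= (1 - y) ^+ n by rewrite exprn_ge0; lra.
apply: le_trans IH; rewrite -mulrA mulrCA ler_wpM2l//; nra.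
Qed.

(** From Bernoulli, |t| (1 - t^2)^n <= |t| / (1 + n t^2), and
    |t| <= d + t^2 / (4 d). *)
Lemma pow_decay (t d : R) n : -1 <= t <= 1 -> 0 < d -> 1 <= 4 * d ^+ 2 * n%:R ->
  (1 - t ^+ 2) ^+ n * `|t| <= d.
Proof.
move=> t1 d0 nd; have y01 : 0 <= t ^+ 2 <= 1 by rewrite sqr_ge0/=; move: t1 => /andP[]; nra.
have := bernoulli_inv n y01; set w := _ ^+ n.
have w0 : 0 <= w by rewrite exprn_ge0; lra.
have s0 := normr_ge0 t; have : `|t| ^+ 2 = t ^+ 2 by rewrite real_normK// num_real.
move: s0; set s := `|t|; set z := t ^+ 2 => s0 sz wz.
have : s <= d * (1 + n%:R * z).
  have : 4 * d * s <= 4 * d * (d * (1 + n%:R * z)).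
    have : 0 <= (s - 2 * d) ^+ 2 by exact: sqr_ge0.
    have : z * 1 <= z * (4 * d ^+ 2 * n%:R) by rewrite ler_wpM2l// sqr_ge0.
    rewrite -sz; nra.
  by rewrite ler_pM2l//; lra.
move=> sd; apply: (@le_trans _ _ (w * (d * (1 + n%:R * z)))).
  by rewrite ler_wpM2l.
by rewrite mulrCA -[leRHS]mulr1 ler_wpM2l// ltW.
Qed.

Lemma cutoff0 : cutoff 0.
Proof. by split; rewrite ?ustar0 ?subr0 ?opn1//; exact: inI0. Qed.

Lemma opn_eq0 g : opn g <= 0 -> forall S, opn (S * g) <= 0.
Proof.
move=> g0 S; apply: le_trans (opnM _ _) _.
by rewrite mulr_ge0_le0// opn_ge0.
Qed.

(** With b = g g^* / ||g||^2 and 1 - e = (1 - b^2)^n one has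
    ||(1 - e) g||^2 = ||g||^2 ||(1 - b^2)^n b (1 - b^2)^n||, which tends to 0.
    Squaring b makes 1 - b^2 a polynomial with values in [0, 1] on the whole
    interval [-1, 1]. *)
Lemma approx_unit1 g (d : R) : inI g -> 0 < d ->
  exists2 e, cutoff e & opn ((1 - e) * g) <= d.
Proof.
move=> Ig d0; have [a Ia gE] := Ig.
have [g0|g0] := leP (opn g) 0.
  exists 0; first exact: cutoff0.
  by apply: le_trans (opn_eq0 g0 _) _; exact: ltW.
pose c := (opn g) ^- 2; have c0 : 0 < c by rewrite invr_gt0 exprn_gt0.
pose b : A := c%:C *: cmul a (cstar a).
have bE : inA b = c%:C *: (g * ustar g) by rewrite gE linearZ/= inAM ustar_inA.
have sb : cstar b = b.
  by apply: (@inA_inj _ A); rewrite -ustar_inA bE ustarZr ustarM ustarK.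
have b1 : nm b <= 1.
  by rewrite -opn_inA bE opnZ_real ?(ltW c0)// opn_Mstar mulVf// expf_neq0// gt_eqF.
have Ib : inI (inA b) by rewrite bE; apply/inIZ/inIMr.
pose eta := c * d ^+ 2.
have eta0 : 0 < eta by rewrite mulr_gt0 ?exprn_gt0.
pose n := Num.bound (eta ^- 2).
have nP : 1 <= 4 * eta ^+ 2 * n%:R.
  have : eta ^- 2 < n%:R by rewrite archi_boundP// invr_ge0 sqr_ge0.
  rewrite -(@ltr_pM2l _ (eta ^+ 2)) ?exprn_gt0// mulfV ?expf_neq0 ?gt_eqF//; lra.
pose p : {poly R} := (1 - 'X ^+ 2) ^+ n.
pose q := pev p (inA b).
have p1 t : -1 <= t <= 1 -> `|p.[t]| <= 1.
  move=> t1; rewrite horner_exp !hornerE normrX exprn_ile1//.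
  by rewrite ler_norml; nra.
have q1 : opn q <= 1 by exact: opn_pev.
have sq : ustar q = q by rewrite ustar_pev// ustar_inA sb.
have qE : q = (1 - inA b * inA b) ^+ n by rewrite /q pevXn pevB pev1 pevXn pevX expr2.
exists (1 - q).
  split; rewrite ?ustarB ?ustar1 ?sq//; last by rewrite subKr.
  rewrite -opprB; apply: inIN; rewrite qE.
  elim: (n) => [|m IH]; first by rewrite expr0 subrr; exact: inI0.
  rewrite exprS; set w := _ ^+ m.
  have -> : (1 - inA b * inA b) * w - 1 = (w - 1) - inA b * (inA b * w) by ncring.
  by apply: inIB => //; exact: inIMr.
rewrite subKr -ler_sqr ?nnegrE ?opn_ge0 ?(ltW d0)// -opn_Mstar ustarM sq.
have -> : q * g * (ustar g * q) = (c^-1)%:C *: pev (p * 'X * p) (inA b).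
  rewrite !pevM pevX -/q bE -scalerAr -scalerAl scalerA -rmorphM/= mulVf ?gt_eqF//.
  by rewrite scale1r; ncring.
rewrite opnZ_real; last by rewrite invr_ge0 ltW.
rewrite ler_pdivrMl// -/eta.
apply: opn_pev => // t t1; have pt : p.[t] = (1 - t ^+ 2) ^+ n.
  by rewrite horner_exp !hornerE.
rewrite !hornerM hornerX pt.
rewrite mulrAC -expr2 -exprM muln2 normrM ger0_norm; last first.
  by rewrite exprn_ge0//; nra.
apply: pow_decay => //; apply: le_trans nP _.
by apply: ler_wpM2l; [rewrite mulr_ge0 ?sqr_ge0|rewrite ler_nat -addnn leq_addr].
Qed.

(** A new element g is treated by an approximate unit e' for (1 - e) g; the
    product (1 - e) (1 - e')^2 (1 - e) is again of the form 1 - (a cutoff). *)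
Lemma approx_unit (s : seq U) (d : R) : (forall g, g \in s -> inI g) -> 0 < d ->
  exists2 e, cutoff e & forall g, g \in s -> opn ((1 - e) * g) <= d.
Proof.
move=> + d0; elim: s => [|g s IH] Is; first by exists 0; [exact: cutoff0|].
have [|e [Ie se e1] eP] := IH; first by move=> h hs; apply: Is; rewrite inE hs orbT.
have Ig : inI g by apply: Is; rewrite inE eqxx.
have [e' [Ie' se' e1'] eP'] : exists2 e', cutoff e' & opn ((1 - e') * ((1 - e) * g)) <= d.
  by apply: approx_unit1 => //; exact: inIMl.
pose q := (1 - e) * (1 - e') * (1 - e') * (1 - e).
have le1 S T : opn S <= 1 -> opn (S * T) <= opn T.
  by move=> S1; apply: le_trans (opnM _ _) _; rewrite ler_piMl ?opn_ge0.
have q3 : opn ((1 - e) * (1 - e') * (1 - e')) <= 1.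
  by rewrite -mulrA; do 2! apply: le_trans (le1 _ _ _) _ => //.
exists (1 - q).
  split.
  - have -> : 1 - q = e + (1 - e) * ((1 - e') * e' + e') * (1 - e) + (1 - e) * e.
      by rewrite /q; ncring.
    apply: inID; last exact: inIMl.
    by apply: inID => //; apply/inIMr/inIMl/inID => //; exact: inIMl.
  - by rewrite ustarB ustar1 /q !ustarM !ustarB !ustar1 se se' !mulrA.
  - rewrite subKr /q; apply: le_trans (le1 _ _ q3) _ => //.
move=> h; rewrite inE subKr => /orP[/eqP->|hs].
  rewrite /q -!mulrA; apply: le_trans (le1 _ _ e1) _.
  by apply: le_trans (le1 _ _ e1') _.
by rewrite /q -mulrA; apply: le_trans (le1 _ _ q3) _; exact: eP.
Qed.

Lemma inI_closed (x : A) :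
  (forall d : R, 0 < d -> exists2 b, ideal_set I b & nm (x - b) <= d) ->
  ideal_set I x.
Proof.
move=> aP; apply: (@ideal_closed _ _ I) => B /nbhs_ballP[_ /= /pos_complexP[d d0 ->] dB].
have [b Ib ab] := aP (d / 2) ltac:(lra); exists b; split => //.
by apply/dB/ball_nm; lra.
Qed.

(** Closed ideals are self-adjoint: g^* is the limit of g^* e with e as in
    [approx_unit1]. *)
Lemma inI_star g : inI g -> inI (ustar g).
Proof.
move=> Ig; have [a Ia gE] := Ig; rewrite gE ustar_inA.
exists (cstar a) => //; apply: inI_closed => d d0.
have [e [Ie se e1] eP] := approx_unit1 Ig d0.
have [b Ib bE] : inI (ustar g * e) by exact: inIMl.
exists b => //; rewrite -opn_inA raddfB/= -ustar_inA -bE -gE -opn_star.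
by rewrite ustarB ustarM ustarK se; have -> : g - e * g = (1 - e) * g by ncring.
Qed.

End Ideal.

(** * Quasi-central elements *)

Section QuasiCentral.
Context (R : realType) (A : cstarAlgType R) (I : ideal A).
Local Notation U := (unitization A).
Implicit Types (S T e g a : U).

(** Each element of the chain is chosen as an approximate unit for finitely many
    elements of I: those of s and the products a * e i with the earlier e i. *)
Lemma cutoff_chain (s F : seq U) m (d : R) : (forall g, g \in s -> inI I g) -> 0 < d ->
  exists e : nat -> U, [/\ forall i, (i < m)%N -> cutoff I (e i),
    forall i g, (i < m)%N -> g \in s -> opn ((1 - e i) * g) <= d &
    forall i l a, (i < l)%N -> (l < m)%N -> a \in F ->
      opn ((1 - e l) * (a * e i)) <= d].
Proof.
move=> Is d0; elim: m => [|m [e [e1 e2 e3]]].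
  by exists (fun _ => 0); split => // i l a _; rewrite ltn0.
have [|f fc fP] := @approx_unit _ _ I (s ++ [seq a * e i | a <- F, i <- iota 0 m]) d _ d0.
  move=> g; rewrite mem_cat => /orP[/Is//|/allpairsP[[a i]/= [aF]]].
  rewrite mem_iota add0n => /e1[Ie _ _ ->]; exact: inIMl.
exists (fun i => if i == m then f else e i); split.
- by move=> i im; case: eqP => // /eqP im'; apply: e1; rewrite ltn_neqAle im' -ltnS.
- move=> i g im gs; case: eqP => [_|/eqP im'].
    by apply: fP; rewrite mem_cat gs.
  by apply: e2 => //; rewrite ltn_neqAle im' -ltnS.
move=> i l a il lm aF.
rewrite (_ : (i == m) = false); last by apply/ltn_eqF/(leq_trans il).
case: eqP => [lE|/eqP lm'].
  apply: fP; rewrite mem_cat; apply/orP; right; apply/allpairsP; exists (a, i).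
  by split => //; rewrite mem_iota add0n -lE.
by apply: e3 => //; rewrite ltn_neqAle lm' -ltnS.
Qed.

(** In X X^* only the m diagonal terms are large. *)
Lemma opn_sum_almost_orthogonal m (X : 'I_m -> U) (D E : R) :
  (forall i, opn (X i * ustar (X i)) <= D) ->
  (forall i l : 'I_m, i != l -> opn (X i * ustar (X l)) <= E) ->
  0 <= D -> 0 <= E ->
  opn (\sum_i X i) ^+ 2 <= m%:R * D + m%:R ^+ 2 * E.
Proof.
move=> XD XE D0 E0; rewrite -opn_Mstar ustar_sum mulr_suml.
apply: le_trans (opn_sum _ _ _) _.
apply: (@le_trans _ _ (\sum_(i < m) (D + m%:R * E))); last first.
  by rewrite sumr_const card_ord -[leLHS]mulr_natl mulrDr mulrA expr2.
apply: ler_sum => i _; rewrite mulr_sumr; apply: le_trans (opn_sum _ _ _) _.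
rewrite (bigD1 i)//=; apply: lerD => //.
apply: (@le_trans _ _ (\sum_(l < m | l != i) E)).
  by apply: ler_sum => l li; apply: XE; rewrite eq_sym.
rewrite sumr_const -[leLHS]mulr_natl ler_wpM2r// ler_nat.
by apply: leq_trans (max_card _) _; rewrite card_ord.
Qed.

(** The terms have almost orthogonal initial spaces:
    e_i a (1 - e_i) (1 - e_l) a^* e_l is small for i < l, because 1 - e_l almost
    kills e_i and a^* e_i.  So the sum has norm of order sqrt m only. *)
Lemma compress_almost_orthogonal m (e : nat -> U) a (C d : R) :
  (forall i, (i < m)%N -> cutoff I (e i)) -> 0 <= d -> opn a <= C ->
  (forall i l, (i < l)%N -> (l < m)%N -> opn ((1 - e l) * e i) <= d) ->
  (forall i l, (i < l)%N -> (l < m)%N -> opn ((1 - e l) * (ustar a * e i)) <= d) ->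
  opn (\sum_(i < m) e i * a * (1 - e i)) ^+ 2 <=
    m%:R * (4 * C ^+ 2) + m%:R ^+ 2 * ((2 * C + 4 * C ^+ 2) * d).
Proof.
move=> ec d0 aC e1 ea; have C0 : 0 <= C := le_trans (opn_ge0 _) aC.
have eaC i : (i < m)%N -> opn (e i * a) <= 2 * C.
  move=> im; apply: le_trans (opnM _ _) _.
  by apply: ler_pM; rewrite ?opn_ge0// (cutoff_le2 (ec _ im)).
have off i l : (i < l)%N -> (l < m)%N ->
    opn (e i * a * (1 - e i) * ustar (e l * a * (1 - e l))) <= (2 * C + 4 * C ^+ 2) * d.
  move=> il lm; have im := ltn_trans il lm.
  have [_ si _] := ec _ im; have [_ sl l1] := ec _ lm.
  have -> : e i * a * (1 - e i) * ustar (e l * a * (1 - e l)) =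
     ustar ((1 - e l) * (ustar a * e i)) * ustar (e l * a)
     - (e i * a) * (ustar ((1 - e l) * e i) * ustar (e l * a)).
    by rewrite !ustarM !ustarB ustar1 ustarK si sl; ncring.
  apply: le_trans (opnD _ _) _; rewrite opnN [leRHS]mulrDl; apply: lerD.
    apply: le_trans (opnM _ _) _; rewrite !opn_star mulrC.
    by apply: ler_pM; [exact: opn_ge0|exact: opn_ge0|exact: eaC|exact: ea].
  apply: le_trans (opnM _ _) _.
  have -> : 4 * C ^+ 2 * d = 2 * C * (d * (2 * C)) by ring.
  apply: ler_pM; [exact: opn_ge0|exact: opn_ge0|exact: eaC|].
  apply: le_trans (opnM _ _) _; rewrite !opn_star.
  by apply: ler_pM; [exact: opn_ge0|exact: opn_ge0|exact: e1|exact: eaC].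
apply: opn_sum_almost_orthogonal.
- move=> i; rewrite opn_Mstar; have im := ltn_ord i.
  have [_ _ i1] := ec _ im.
  have -> : 4 * C ^+ 2 = (2 * C) ^+ 2 by ring.
  rewrite ler_sqr ?nnegrE ?opn_ge0 ?mulr_ge0//.
  apply: le_trans (opnM _ _) _; rewrite -[leRHS]mulr1.
  by apply: ler_pM; rewrite ?opn_ge0 ?eaC.
- move=> i l il; have := il; rewrite neq_ltn => /orP[{}il|{}il]; first exact: off.
  by rewrite -opn_star ustarM ustarK; exact: off.
- by rewrite mulr_ge0 ?sqr_ge0.
- by rewrite mulr_ge0// addr_ge0 ?mulr_ge0 ?sqr_ge0.
Qed.

(** The average e of a chain e_0, ..., e_(m-1) of approximate units almost
    commutes with a: e_i a - a e_i = e_i a (1 - e_i) - (1 - e_i) a e_i, and by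
    [compress_almost_orthogonal] the sum of these m terms has norm of order
    sqrt m. *)
Lemma quasi_central (s F : seq U) (d : R) : (forall g, g \in s -> inI I g) -> 0 < d ->
  exists e, [/\ cutoff I e, forall g, g \in s -> opn ((1 - e) * g) <= d &
    forall a, a \in F -> opn (e * a - a * e) <= d].
Proof.
move=> Is d0.
have [C C0 CF] : exists2 C : R, 0 <= C & forall a, a \in F -> opn a <= C.
  exists (\sum_(a <- F) opn a); first by apply: sumr_ge0 => a _; exact: opn_ge0.
  move=> a aF; rewrite (big_rem a)//= lerDl.
  by apply: sumr_ge0 => b _; exact: opn_ge0.
pose K := 4 * C ^+ 2 + 1.
have K0 : 0 < K by have := sqr_ge0 C; rewrite /K; lra.
pose m := (Num.bound (4 * K / d ^+ 2)).+1.
have mP : 4 * K <= m%:R * d ^+ 2.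
  rewrite -ler_pdivrMr ?exprn_gt0// ltW// (lt_trans (archi_boundP _))//.
  - by rewrite divr_ge0 ?sqr_ge0 ?mulr_ge0 ?(ltW K0).
  - by rewrite ltr_nat.
have m0 : 0 < m%:R :> R by rewrite ltr0n.
pose L := 2 * C + 4 * C ^+ 2 + 1.
have L0 : 0 < L by rewrite /L; have := sqr_ge0 C; lra.
pose h := Num.min d (m%:R * L)^-1.
have h0 : 0 < h by rewrite lt_min d0 invr_gt0 mulr_gt0.
have hd : h <= d by rewrite ge_min lexx.
have hL : m%:R * ((2 * C + 4 * C ^+ 2) * h) <= 1.
  apply: (@le_trans _ _ (m%:R * L * h)).
    by rewrite -mulrA ler_wpM2l ?(ltW m0)// ler_wpM2r ?(ltW h0)// /L; lra.
  rewrite -ler_pdivlMl ?mulr_gt0// mulr1 ge_min lexx orbT//.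
pose F' := 1 :: F ++ [seq ustar a | a <- F].
have [e [ec es eF]] := @cutoff_chain s F' m h Is h0.
have mm : (m%:R^-1)%:C * m%:R = 1 :> R[i].
  by rewrite -(rmorph_nat (real_complex R)) -rmorphM/= mulVf ?gt_eqF// rmorph1.
pose f : U := (m%:R^-1)%:C *: \sum_(i < m) e i.
have fE (G : U -> U) : (forall S T, G (S + T) = G S + G T) ->
    (forall c S, G (c *: S) = c *: G S) ->
    G f = (m%:R^-1)%:C *: \sum_(i < m) G (e i).
  move=> GD GZ; rewrite /f GZ; congr (_ *: _); apply: (big_morph G GD).
  by have := GZ 0 0; rewrite !scale0r.
have avg (G : 'I_m -> U) (D : R) : (forall i, opn (G i) <= D) ->
    opn ((m%:R^-1)%:C *: \sum_(i < m) G i) <= D.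
  move=> GD; rewrite opnZ_real ?invr_ge0 ?(ltW m0)// ler_pdivrMl//.
  apply: le_trans (opn_sum _ _ _) _.
  by apply: le_trans (ler_sum _ (fun i _ => GD i)) _; rewrite sumr_const card_ord mulr_natl.
have f1 g : (1 - f) * g = (m%:R^-1)%:C *: \sum_(i < m) (1 - e i) * g.
  rewrite -mulr_suml sumrB sumr_const card_ord scalerAl scalerBr -/f.
  by rewrite -(scaler_nat m (1 : U)) scalerA mm scale1r.
exists f; split.
- split.
  + by apply/inIZ/inI_sum => i _; have [] := ec i (ltn_ord i).
  + rewrite /f ustarZr ustar_sum; congr (_ *: _); apply: eq_bigr => i _.
    by have [] := ec i (ltn_ord i).
  + rewrite -[1 - f]mulr1 f1; apply: avg => i; rewrite mulr1.
    by have [] := ec i (ltn_ord i).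
- move=> g gs; rewrite f1; apply: avg => i; apply: le_trans hd.
  by apply: es.
move=> a aF; pose X b := \sum_(i < m) e i * b * (1 - e i).
have XP b : b \in F \/ (exists2 c, c \in F & b = ustar c) -> opn b <= C ->
    (m%:R^-1) * opn (X b) <= d / 2.
  move=> bF bC; have : opn (X b) ^+ 2 <= m%:R * K.
    apply: le_trans (@compress_almost_orthogonal m e b C h ec (ltW h0) bC _ _) _.
    - by move=> i l il lm; have := eF i l 1 il lm; rewrite mul1r; apply; rewrite inE eqxx.
    - move=> i l il lm; apply: eF => //; rewrite inE mem_cat; apply/orP; right.
      case: bF => [bF|[c cF ->]]; last by rewrite ustarK cF.
      by apply/orP; right; apply/mapP; exists b.
    rewrite expr2 -mulrA -mulrDr ler_wpM2l ?(ltW m0)// /K lerD//.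
  move=> XK; rewrite -ler_sqr ?nnegrE ?mulr_ge0 ?invr_ge0 ?opn_ge0 ?(ltW m0)//; last lra.
  rewrite exprMn; apply: (@le_trans _ _ (m%:R^-1 ^+ 2 * (m%:R * K))).
    by rewrite ler_wpM2l ?sqr_ge0.
  rewrite expr2 -mulrA mulKf ?gt_eqF// ler_pdivrMl//.
  have -> : m%:R * (d / 2) ^+ 2 = m%:R * d ^+ 2 / 4 by field.
  lra.
have -> : f * a - a * f = (m%:R^-1)%:C *: (X a - ustar (X (ustar a))).
  rewrite (fE (fun T => T * a - a * T)); last 2 first.
  - by move=> S T; ncring.
  - by move=> c S; rewrite -scalerAl -scalerAr scalerBr.
  congr (_ *: _); rewrite /X ustar_sum -sumrB; apply: eq_bigr => i _.
  have [_ si _] := ec i (ltn_ord i).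
  by rewrite !ustarM ustarB ustar1 ustarK si; ncring.
rewrite opnZ_real ?invr_ge0 ?(ltW m0)//.
apply: (@le_trans _ _ (m%:R^-1 * (opn (X a) + opn (X (ustar a))))).
  rewrite ler_wpM2l ?invr_ge0 ?(ltW m0)//; apply: le_trans (opnD _ _) _.
  by rewrite opnN opn_star.
rewrite mulrDr [leRHS](_ : d = d / 2 + d / 2); last by field.
apply: lerD; apply: XP; rewrite ?opn_star ?CF//; first by left.
by right; exists a.
Qed.

End QuasiCentral.

(** * Quotient seminorm *)

Section QuotientNorm.
Context (R : realType) (A : cstarAlgType R) (I : ideal A).
Local Notation U := (unitization A).
Implicit Types (S T e g a j : U).

(** On [A] this is the norm of the quotient ([quot_norm_qn]); on the unitization
    it also applies to factors such as 1 - e. *)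
Definition qn T : R := inf [set opn (T + j) | j in [set j | inI I j]].

Let qn_has_inf T : has_inf [set opn (T + j) | j in [set j | inI I j]].
Proof.
split; first by exists (opn (T + 0)), 0 => //; exact: inI0.
by exists 0 => _ [j _ <-]; exact: opn_ge0.
Qed.

Lemma qn_le T j : inI I j -> qn T <= opn (T + j).
Proof. by move=> Ij; apply: ge_inf; [have [] := qn_has_inf T|exists j]. Qed.

Lemma qn_le_opn T : qn T <= opn T.
Proof. by have := qn_le T (inI0 I); rewrite addr0. Qed.

Lemma le_qn T c : (forall j, inI I j -> c <= opn (T + j)) -> c <= qn T.
Proof.
move=> h; apply: lb_le_inf; first by have [] := qn_has_inf T.
by move=> _ [j Ij <-]; exact: h.
Qed.

Lemma qn_ge0 T : 0 <= qn T.
Proof. by apply: le_qn => j _; exact: opn_ge0. Qed.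

Lemma qn_adherent T (d : R) : 0 < d -> exists2 j, inI I j & opn (T + j) < qn T + d.
Proof.
by move=> d0; have [_ [j Ij <-] jT] := inf_adherent d0 (qn_has_inf T); exists j.
Qed.

Lemma qn_congr S T : inI I (S - T) -> qn S = qn T.
Proof.
have le S' T' : inI I (S' - T') -> qn S' <= qn T'.
  move=> ST; apply: le_qn => j Ij.
  have -> : T' + j = S' + (j - (S' - T')) by ncring.
  by apply: qn_le; exact: inIB.
move=> ST; apply/le_anti; rewrite !le// -opprB; exact: inIN.
Qed.

Lemma qnD S T : qn (S + T) <= qn S + qn T.
Proof.
apply/ler_addgt0Pl => d d0; have d2 : 0 < d / 2 by lra.
have [j Ij jS] := qn_adherent S d2; have [k Ik kT] := qn_adherent T d2.
have := qn_le (S + T) (inID Ij Ik); rewrite addrACA.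
have := opnD (S + j) (T + k); lra.
Qed.

Lemma qnN T : qn (- T) = qn T.
Proof.
have le S : qn (- S) <= qn S.
  by apply: le_qn => j Ij; rewrite -opnN opprD; apply: qn_le; exact: inIN.
by apply/le_anti; rewrite le -{1}(opprK T) le.
Qed.

Lemma qnM S T : qn (S * T) <= qn S * qn T.
Proof.
have step j k : inI I j -> inI I k -> qn (S * T) <= opn (S + j) * opn (T + k).
  move=> Ij Ik; rewrite -(@qn_congr ((S + j) * (T + k))); last first.
    have -> : (S + j) * (T + k) - S * T = S * k + j * (T + k) by ncring.
    by apply: inID; [exact: inIMl|exact: inIMr].
  by apply: le_trans (qn_le_opn _) _; exact: opnM.
apply/ler_addgt0Pl => d d0.
pose c := qn S + qn T + 1.
have c1 : 1 <= c by have := qn_ge0 S; have := qn_ge0 T; rewrite /c; lra.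
pose h := Num.min 1 (d / c).
have h0 : 0 < h by rewrite lt_min ltr01 divr_gt0//; lra.
have hc : h * c <= d by rewrite -ler_pdivlMr ?ge_min ?lexx ?orbT//; lra.
have h1 : h <= 1 by rewrite ge_min lexx.
have [j Ij jS] := qn_adherent S h0; have [k Ik kT] := qn_adherent T h0.
apply: le_trans (step j k Ij Ik) _.
apply: (@le_trans _ _ ((qn S + h) * (qn T + h))).
  by apply: ler_pM; [exact: opn_ge0|exact: opn_ge0|exact: ltW|exact: ltW].
have := qn_ge0 S; have := qn_ge0 T; rewrite /c in hc; nra.
Qed.

Lemma qn_star T : qn (ustar T) = qn T.
Proof.
have le S : qn (ustar S) <= qn S.
  apply: le_qn => j Ij; rewrite -opn_star ustarD; apply: qn_le; exact: inI_star.
by apply/le_anti; rewrite le -{1}(ustarK T) le.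
Qed.

Lemma qnX_le T n : qn (T ^+ n.+1) <= qn T ^+ n.+1.
Proof.
elim: n => [|n IH]; first by rewrite !expr1.
rewrite exprS [leRHS]exprS; apply: le_trans (qnM _ _) _.
by rewrite ler_wpM2l ?qn_ge0.
Qed.

(** If j in I almost realizes the distance of T to I, then
    (1 - e) T = (1 - e) (T + j) - (1 - e) j, and the last term is small as soon as
    e is an approximate unit for j. *)
Lemma cutoff_qn (s : seq U) (d : R) : 0 < d -> exists2 s' : seq U,
  forall g, g \in s' -> inI I g &
  forall e, cutoff I e -> (forall g, g \in s' -> opn ((1 - e) * g) <= d) ->
    forall T, T \in s -> opn ((1 - e) * T) <= qn T + 2 * d /\
                      opn (T * (1 - e)) <= qn T + 2 * d.
Proof.
move=> d0; elim: s => [|T s [s' Is' s'P]]; first by exists [::].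
have [j Ij jT] := qn_adherent T d0.
exists (j :: ustar j :: s').
  by move=> g; rewrite !inE => /or3P[/eqP->|/eqP->|/Is'//]//; exact: inI_star.
move=> e ec eP S; rewrite inE => /orP[/eqP->|]; last first.
  by apply: s'P => // g gs; apply: eP; rewrite !inE gs !orbT.
have [_ se e1] := ec.
have ej : opn ((1 - e) * j) <= d by apply: eP; rewrite inE eqxx.
have je : opn (j * (1 - e)) <= d.
  by rewrite -opn_star ustarM ustarB ustar1 se; apply: eP; rewrite !inE eqxx orbT.
have Tj0 := opn_ge0 (T + j).
split.
- have -> : (1 - e) * T = (1 - e) * (T + j) - (1 - e) * j by ncring.
  apply: le_trans (opnD _ _) _; rewrite opnN.
  have := opnM (1 - e) (T + j); have := opn_ge0 (1 - e); nra.
- have -> : T * (1 - e) = (T + j) * (1 - e) - j * (1 - e) by ncring.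
  apply: le_trans (opnD _ _) _; rewrite opnN.
  have := opnM (T + j) (1 - e); have := opn_ge0 (1 - e); nra.
Qed.

End QuotientNorm.

(** * Calculus modulo commutators *)

Section AlmostCommuting.
Context (R : realType) (A : cstarAlgType R) (F : seq (unitization A)).
Local Notation U := (unitization A).
Implicit Types (f g : U -> U) (a b p : U) (h : R).

(** The admissible values of the variable [p] in the calculus below. *)
Record almost_central p h : Prop := AlmostCentral {
  almost_central_star : ustar p = p;
  almost_central_le1 : opn p <= 1;
  almost_central_comm : forall a, a \in F -> opn (p * a - a * p) <= h
}.

(** The constant depends on neither [p] nor [h], so that identities which hold
    when p commutes with F may be used before p is chosen. *)
Definition aeq f g := exists2 C : R, 0 <= C &
  forall p h, almost_central p h -> opn (f p - g p) <= C * h.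

Definition abounded f := exists2 C : R, 0 <= C &
  forall p h, almost_central p h -> opn (f p) <= C.

Lemma aeq_refl f : aeq f f.
Proof. by exists 0 => // p h _; rewrite subrr mul0r opn0. Qed.

Lemma aeq_trans f1 f2 f3 : aeq f1 f2 -> aeq f2 f3 -> aeq f1 f3.
Proof.
move=> [C C0 f12] [D D0 f23]; exists (C + D); first by rewrite addr_ge0.
move=> p h ph; have -> : f1 p - f3 p = (f1 p - f2 p) + (f2 p - f3 p) by ncring.
rewrite mulrDl; apply: le_trans (opnD _ _) _.
by apply: lerD; [exact: f12|exact: f23].
Qed.

Lemma abounded_cst a : abounded (fun _ => a).
Proof. by exists (opn a) => //; exact: opn_ge0. Qed.

Lemma abounded_id : abounded id.
Proof. by exists 1 => // p h []. Qed.

Lemma aboundedM f g : abounded f -> abounded g -> abounded (fun p => f p * g p).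
Proof.
move=> [C C0 fC] [D D0 gD]; exists (C * D); first by rewrite mulr_ge0.
move=> p h ph; apply: le_trans (opnM _ _) _.
by apply: ler_pM; [exact: opn_ge0|exact: opn_ge0|exact: fC ph|exact: gD ph].
Qed.

Lemma aboundedX f n : abounded f -> abounded (fun p => f p ^+ n).
Proof.
move=> fb; elim: n => [|n IH]; first exact: abounded_cst.
have [C C0 H] := aboundedM fb IH; exists C => // p h ph.
by rewrite exprS; exact: H ph.
Qed.

Lemma aeqM f f' g g' : aeq f f' -> aeq g g' -> abounded g -> abounded f' ->
  aeq (fun p => f p * g p) (fun p => f' p * g' p).
Proof.
move=> [C C0 ff] [D D0 gg] [E E0 gE] [G G0 fG]; exists (C * E + G * D).
  by rewrite addr_ge0 ?mulr_ge0.
move=> p h ph.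
have -> : f p * g p - f' p * g' p = (f p - f' p) * g p + f' p * (g p - g' p) by ncring.
apply: le_trans (opnD _ _) _; rewrite [leRHS]mulrDl; apply: lerD.
  apply: le_trans (opnM _ _) _; rewrite mulrAC.
  by apply: ler_pM; [exact: opn_ge0|exact: opn_ge0|exact: ff|exact: gE ph].
apply: le_trans (opnM _ _) _; rewrite -mulrA.
by apply: ler_pM; [exact: opn_ge0|exact: opn_ge0|exact: fG ph|exact: gg].
Qed.

Lemma aeq_star f g : aeq f g -> aeq (fun p => ustar (f p)) (fun p => ustar (g p)).
Proof.
by move=> [C C0 fg]; exists C => // p h ph; rewrite -ustarB opn_star; exact: fg.
Qed.

Lemma aeq_ext f g : (forall p, ustar p = p -> f p = g p) -> aeq f g.
Proof.
by move=> fg; exists 0 => // p h [sp _ _]; rewrite fg// subrr opn0 mul0r.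
Qed.

Definition acommutes a := aeq (fun p => p * a) (fun p => a * p).

Lemma acommutes_mem a : a \in F -> acommutes a.
Proof. by move=> aF; exists 1 => // p h [_ _ pF]; rewrite mul1r; exact: pF. Qed.

Lemma acommutesM a b : acommutes a -> acommutes b -> acommutes (a * b).
Proof.
move=> ca cb; apply: (@aeq_trans _ (fun p => (a * p) * b)).
  apply: (@aeq_trans _ (fun p => (p * a) * b)).
    by apply: aeq_ext => p _; rewrite mulrA.
  apply: aeqM => //; [exact: aeq_refl|exact: abounded_cst|].
  by apply: aboundedM; [exact: abounded_cst|exact: abounded_id].
apply: (@aeq_trans _ (fun p => a * (p * b))).
  by apply: aeq_ext => p _; rewrite mulrA.
apply: (@aeq_trans _ (fun p => a * (b * p))).
  apply: aeqM => //; [exact: aeq_refl| |exact: abounded_cst].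
  by apply: aboundedM; [exact: abounded_id|exact: abounded_cst].
by apply: aeq_ext => p _; rewrite mulrA.
Qed.

Lemma acommutes1 : acommutes 1.
Proof. by apply: aeq_ext => p _; rewrite mulr1 mul1r. Qed.

Lemma acommutesX a n : acommutes a -> acommutes (a ^+ n).
Proof.
move=> ca; elim: n => [|n IH]; first exact: acommutes1.
by rewrite exprS; exact: acommutesM.
Qed.

Lemma acommutes_powr a n : acommutes a -> aeq (fun p => p ^+ n * a) (fun p => a * p ^+ n).
Proof.
move=> ca; elim: n => [|n IH]; first by apply: aeq_ext => p _; rewrite !expr0 mulr1 mul1r.
apply: (@aeq_trans _ (fun p => p * (p ^+ n * a))).
  by apply: aeq_ext => p _; rewrite exprS mulrA.
apply: (@aeq_trans _ (fun p => p * (a * p ^+ n))).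
  apply: aeqM => //; [exact: aeq_refl| |exact: abounded_id].
  by apply: aboundedM; [exact/aboundedX/abounded_id|exact: abounded_cst].
apply: (@aeq_trans _ (fun p => (p * a) * p ^+ n)).
  by apply: aeq_ext => p _; rewrite mulrA.
apply: (@aeq_trans _ (fun p => (a * p) * p ^+ n)).
  apply: aeqM => //; [exact: aeq_refl|exact/aboundedX/abounded_id|].
  by apply: aboundedM; [exact: abounded_cst|exact: abounded_id].
by apply: aeq_ext => p _; rewrite exprS mulrA.
Qed.

Lemma aeqX_mul a k n : acommutes a ->
  aeq (fun p => (a * p ^+ k) ^+ n) (fun p => a ^+ n * p ^+ (k * n)).
Proof.
have bk m : abounded (fun p => p ^+ m) by exact/aboundedX/abounded_id.
have ba b : abounded (fun=> b) by exact: abounded_cst.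
move=> ca; elim: n => [|n IH].
  by apply: aeq_ext => p _; rewrite muln0 !expr0 mulr1.
apply: (@aeq_trans _ (fun p => (a * p ^+ k) ^+ n * (a * p ^+ k))).
  by apply: aeq_ext => p _; rewrite exprSr.
apply: (@aeq_trans _ (fun p => (a ^+ n * p ^+ (k * n)) * (a * p ^+ k))).
  apply: aeqM => //; [exact: aeq_refl| |]; exact: aboundedM.
apply: (@aeq_trans _ (fun p => (a ^+ n * (p ^+ (k * n) * a)) * p ^+ k)).
  by apply: aeq_ext => p _; rewrite !mulrA.
apply: (@aeq_trans _ (fun p => (a ^+ n * (a * p ^+ (k * n))) * p ^+ k)).
  apply: aeqM => //; [|exact: aeq_refl|].
    by apply: aeqM => //; [exact: aeq_refl|exact: acommutes_powr|exact: aboundedM].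
  by apply: aboundedM => //; exact: aboundedM.
by apply: aeq_ext => p _; rewrite mulnS addnC exprD exprSr !mulrA.
Qed.

Lemma aeqX f g n : aeq f g -> abounded f -> abounded g ->
  aeq (fun p => f p ^+ n) (fun p => g p ^+ n).
Proof.
move=> fg bf bg; elim: n => [|n IH]; first exact: aeq_refl.
apply: (@aeq_trans _ (fun p => f p * f p ^+ n)).
  by apply: aeq_ext => p _; rewrite exprS.
apply: (@aeq_trans _ (fun p => g p * g p ^+ n)).
  by apply: aeqM => //; exact: aboundedX.
by apply: aeq_ext => p _; rewrite exprS.
Qed.

End AlmostCommuting.

(** * Reducing the norms of powers *)

Section NormAdjust.
Context (R : realType) (A : cstarAlgType R) (I : ideal A).
Local Notation U := (unitization A).
Implicit Types (x u p : U).

Lemma exists_bound (P : nat -> R -> Prop) :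
  (forall n, exists2 C : R, 0 <= C & P n C) ->
  (forall n C C', C <= C' -> P n C -> P n C') ->
  forall N, exists2 C : R, 0 <= C & forall n, (n <= N)%N -> P n C.
Proof.
move=> Pex Pmono; elim=> [|N [C C0 CP]].
  by have [C C0 CP] := Pex 0; exists C => // n; rewrite leqn0 => /eqP ->.
have [D D0 DP] := Pex N.+1; exists (Num.max C D); first by rewrite le_max C0.
move=> n; rewrite leq_eqVlt => /orP[/eqP->|nN].
  by apply: Pmono DP; rewrite le_max lexx orbT.
by apply: Pmono (CP n nN); rewrite le_max lexx.
Qed.

(** For T = (x p)^n, the power 2^(m+1) of ||T|| is ||(T^* T)^(2^m)||, and modulo
    commutators (T^* T)^(2^m) is (z^* z)^(2^m) p^(2n 2^m) with z = x^n. *)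
Lemma word_bound x n m : exists2 C : R, 0 <= C &
  forall p h, almost_central [:: x; ustar x] p h ->
  opn ((x * p) ^+ n) ^+ (2 * 2 ^ m) <=
  opn ((ustar (x ^+ n) * x ^+ n) ^+ (2 ^ m) * p ^+ (2 * n * 2 ^ m)) + C * h.
Proof.
set F := [:: x; ustar x]; set z := x ^+ n.
have cx : acommutes F x by apply: acommutes_mem; rewrite inE eqxx.
have csx : acommutes F (ustar x) by apply: acommutes_mem; rewrite !inE eqxx orbT.
have cz : acommutes F (ustar z * z).
  by apply: acommutesM; rewrite ?ustarX; exact: acommutesX.
have bk k : abounded F (fun p => p ^+ k) by exact/aboundedX/abounded_id.
have ba b : abounded F (fun=> b) by exact: abounded_cst.
have T1 : aeq F (fun p => (x * p) ^+ n) (fun p => z * p ^+ n).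
  apply: (@aeq_trans _ _ _ _ (fun p => (x * p ^+ 1) ^+ n)).
    by apply: aeq_ext => p _; rewrite expr1.
  by have := aeqX_mul 1 n cx; rewrite mul1n.
have bT : abounded F (fun p => (x * p) ^+ n).
  by apply/aboundedX/aboundedM; [exact: ba|exact: abounded_id].
have bsz : abounded F (fun p => ustar (z * p ^+ n)).
  have [C C0 H] : abounded F (fun p => z * p ^+ n) by exact: aboundedM.
  by exists C => // p h /H; rewrite opn_star.
have T2 : aeq F (fun p => ustar ((x * p) ^+ n) * (x * p) ^+ n)
    (fun p => (ustar z * z) * p ^+ (2 * n)).
  apply: (@aeq_trans _ _ _ _ (fun p => ustar (z * p ^+ n) * (z * p ^+ n))).
    by apply: aeqM => //; exact: aeq_star.
  apply: (@aeq_trans _ _ _ _ (fun p => p ^+ n * (ustar z * z) * p ^+ n)).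
    by apply: aeq_ext => p sp; rewrite ustarM ustarX sp !mulrA.
  apply: (@aeq_trans _ _ _ _ (fun p => (ustar z * z) * p ^+ n * p ^+ n)).
    apply: aeqM => //; [exact: acommutes_powr|exact: aeq_refl|].
    exact: aboundedM.
  by apply: aeq_ext => p _; rewrite -mulrA -exprD addnn mul2n.
have bsT : abounded F (fun p => ustar ((x * p) ^+ n)).
  by have [C C0 H] := bT; exists C => // p h /H; rewrite opn_star.
have [C C0 H] : aeq F (fun p => (ustar ((x * p) ^+ n) * (x * p) ^+ n) ^+ (2 ^ m))
    (fun p => (ustar z * z) ^+ (2 ^ m) * p ^+ (2 * n * 2 ^ m)).
  apply: (@aeq_trans _ _ _ _ (fun p => (ustar z * z * p ^+ (2 * n)) ^+ (2 ^ m))).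
    by apply: aeqX => //; exact: aboundedM.
  exact: aeqX_mul.
exists C => // p h ph; rewrite exprM -opn_starM -opn_sa_X2; last first.
  by rewrite ustarM ustarK.
have := H p h ph; set S := _ ^+ _; set T := _ * _ => ST.
rewrite -[S](subrK T) addrC; apply: le_trans (opnD _ _) _.
by rewrite lerD2l.
Qed.

(** Where u acts like 1, the factor 1 - t u is 1 - t. *)
Lemma cutoff_power u v (t h : R) L : 0 <= t <= 1 -> 0 <= h ->
  opn (1 - t%:C *: u) <= 1 -> opn (v * (1 - u)) <= h ->
  opn (v * (1 - t%:C *: u) ^+ L - ((1 - t) ^+ L)%:C *: v) <= L%:R * h.
Proof.
move=> t01 h0 p1 vu; set p := 1 - _.
elim: L => [|L IH]; first by rewrite !expr0 mulr1 scale1r subrr opn0 mul0r.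
have -> : v * p ^+ L.+1 - ((1 - t) ^+ L.+1)%:C *: v =
    (v * p ^+ L - ((1 - t) ^+ L)%:C *: v) * p +
    ((1 - t) ^+ L * t)%:C *: (v * (1 - u)).
  have vp : v * p = v - t%:C *: (v * u) by rewrite /p mulrBr mulr1 scalerAr.
  set c := ((1 - t) ^+ L)%:C.
  have c1 : ((1 - t) ^+ L.+1)%:C = c - c * t%:C.
    by rewrite exprSr rmorphM rmorphB rmorph1 mulrBr mulr1.
  rewrite c1 [(_ * t)%:C]rmorphM/= -/c scalerBl exprSr mulrBl -scalerAl vp.
  rewrite (mulrBr v) mulr1 !scalerBr !scalerA mulrA.
  set a1 := c *: v; set a2 := (c * _) *: v; set a3 := _ *: (v * u).
  ncring.
rewrite -natr1 [leRHS]mulrDl mul1r; apply: le_trans (opnD _ _) _; apply: lerD.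
  by apply: le_trans (opnM _ _) _; apply: le_trans IH; rewrite ler_piMr ?opn_ge0.
have c0 : 0 <= (1 - t) ^+ L * t by rewrite mulr_ge0 ?exprn_ge0; lra.
rewrite opnZ_real//; apply: le_trans vu.
rewrite ler_piMl ?opn_ge0// mulr_ile1 ?exprn_ge0 ?exprn_ile1; lra.
Qed.

(** Taking high powers absorbs the constant 4. *)
Lemma pow_gap (B e : R) : 0 <= B -> 0 < e -> exists m, forall b, 0 <= b <= B ->
  4 * (b + e / 2) ^+ (2 * 2 ^ m) <= (b + e) ^+ (2 * 2 ^ m).
Proof.
move=> B0 e0; pose r := (e / 2) / (B + e / 2).
have r0 : 0 < r by rewrite divr_gt0//; lra.
pose m := Num.bound (3 / r); exists m => b /andP[b0 bB].
have km : (m <= 2 * 2 ^ m)%N.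
  by apply: leq_trans (ltnW (ltn_expl m (ltnSn 1))) _; rewrite leq_pmull.
have rm : 3 <= r * (2 * 2 ^ m)%:R.
  rewrite mulrC -ler_pdivrMr//; apply: (@le_trans _ _ m%:R); last by rewrite ler_nat.
  by apply/ltW/archi_boundP; rewrite divr_ge0// ltW.
set k := (2 * 2 ^ m)%N in rm *.
have bern j : 1 + r * j%:R <= (1 + r) ^+ j.
  elim: j => [|j IH]; first by rewrite mulr0 addr0 expr0.
  rewrite exprS -natr1; have j0 : 0 <= j%:R :> R by [].
  by move: IH; set w := _ ^+ j; nra.
have be : (1 + r) * (b + e / 2) <= b + e.
  have : r * (b + e / 2) <= e / 2.
    rewrite /r mulrAC ler_pdivrMr; last lra.
    by rewrite ler_wpM2l; lra.
  lra.
apply: (@le_trans _ _ (((1 + r) * (b + e / 2)) ^+ k)).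
  rewrite exprMn ler_wpM2r ?exprn_ge0//; first lra.
  by have := bern k; lra.
by apply: lerXn2r be; rewrite nnegrE ?mulr_ge0//; lra.
Qed.

(** In (z^* z)^(2^m) (1 - t u)^L, split 1 = (1 - v) + v with v in I such that 1 - v
    cuts (z^* z)^(2^m) down to its quotient norm, and u almost 1 on v.  The
    first part is bounded by a power of ||pi z||, the second one by the same
    power of (1 - t) ||z||.  Adding the two bounds costs a constant factor,
    which is harmless after taking the 2^(m+1)-st root. *)
Lemma norm_adjust x N (t e : R) : 0 <= t <= 1 -> 0 < e ->
  exists2 u, cutoff I u & forall n, (0 < n <= N)%N ->
    opn ((x * (1 - t%:C *: u)) ^+ n) <=
    Num.max (qn I (x ^+ n)) ((1 - t) * opn (x ^+ n)) + e.
Proof.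
move=> t01 e0.
pose B := \sum_(n < N.+1) opn (x ^+ n).
have BP n : (n <= N)%N -> opn (x ^+ n) <= B.
  move=> nN; rewrite /B (bigD1 (Ordinal (nN : n < N.+1)%N))//= lerDl.
  by apply: sumr_ge0 => i _; exact: opn_ge0.
have B0 : 0 <= B := le_trans (opn_ge0 _) (BP 0%N (leq0n N)).
have [m mP] := pow_gap B0 e0; set k := (2 * 2 ^ m)%N in mP.
pose w n := (ustar (x ^+ n) * x ^+ n) ^+ (2 ^ m).
pose eta := (e / 2) ^+ k; have eta0 : 0 < eta by rewrite exprn_gt0//; lra.
have wk n : opn (w n) <= opn (x ^+ n) ^+ k.
  rewrite /w /k exprM -opn_starM; elim: (2 ^ m)%N => [|j IH]; first exact: opn1.
  rewrite exprS [leRHS]exprS; apply: le_trans (opnM _ _) _.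
  by rewrite ler_wpM2l ?opn_ge0.
have qk n : qn I (w n) <= qn I (x ^+ n) ^+ k.
  rewrite /w /k; have /prednK <- : (0 < 2 ^ m)%N by rewrite expn_gt0.
  apply: le_trans (qnX_le _ _ _) _; rewrite exprM; apply: lerXn2r; rewrite ?nnegrE ?qn_ge0 ?sqr_ge0//.
  by apply: le_trans (qnM _ _ _) _; rewrite qn_star expr2.
have [C C0 CP] : exists2 C : R, 0 <= C & forall n, (n <= N)%N -> forall p h,
    almost_central [:: x; ustar x] p h -> 0 <= h ->
    opn ((x * p) ^+ n) ^+ k <= opn (w n * p ^+ (2 * n * 2 ^ m)) + C * h /\
    opn (w n) * (2 * n * 2 ^ m)%:R <= C.
  apply: exists_bound.
    move=> n; have [C C0 CP] := word_bound x n m.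
    exists (C + opn (w n) * (2 * n * 2 ^ m)%:R).
      by rewrite addr_ge0// mulr_ge0// opn_ge0.
    move=> p h ph h0; split; last by rewrite lerDr.
    apply: le_trans (CP p h ph) _; rewrite lerD2l ler_wpM2r// lerDl.
    by rewrite mulr_ge0// opn_ge0.
  move=> n C C' CC CP p h ph h0; have [c1 c2] := CP p h ph h0.
  split; last exact: le_trans CC.
  by apply: le_trans c1 _; rewrite lerD2l ler_wpM2r.
have d0 : 0 < eta / 4 by lra.
have [s' Is' s'P] := @cutoff_qn _ _ I [seq w n | n <- iota 0 N.+1] _ d0.
have [v vc vs] := approx_unit Is' d0.
have [_ sv _] := vc.
pose h := eta / (4 * (C + 1)).
have C1 : 0 < 4 * (C + 1) by lra.
have h0 : 0 < h by rewrite divr_gt0.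
have Ch : C * h <= eta / 4.
  have -> : eta / 4 = (C + 1) * h by rewrite /h; field; lra.
  by rewrite ler_wpM2r ?(ltW h0)//; lra.
have [u [uc us uF]] : exists u, [/\ cutoff I u,
    forall g, g \in [:: v] -> opn ((1 - u) * g) <= h &
    forall a, a \in [:: x; ustar x] -> opn (u * a - a * u) <= h].
  apply: quasi_central => // g; rewrite inE => /eqP ->; by case: vc.
exists u => // n /andP[n0 nN].
have [_ su u1] := uc; set p := 1 - t%:C *: u.
have p1 : opn p <= 1.
  have -> : p = (1 - t)%:C *: 1 + t%:C *: (1 - u).
    rewrite /p rmorphB rmorph1 scalerBl scalerBr scale1r.
    by set a1 := _ *: 1; set a2 := _ *: u; ncring.
  apply: le_trans (opnD _ _) _; rewrite !opnZ_real; try lra.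
  have := opn1 A; have := opn_ge0 (1 : U); nra.
have sp : ustar p = p by rewrite /p ustarB ustar1 ustarZr su.
have ph : almost_central [:: x; ustar x] p h.
  split => // a aF; have -> : p * a - a * p = (- t%:C) *: (u * a - a * u).
    rewrite /p mulrBl mulrBr mul1r mulr1 -scalerAl -scalerAr scaleNr scalerBr.
    by set a1 := _ *: _; set a2 := _ *: (a * u); ncring.
  rewrite scaleNr opnN opnZ_real; last lra.
  by apply: le_trans (uF a aF); rewrite ler_piMl ?opn_ge0//; lra.
have vu : opn (v * (1 - u)) <= h.
  by rewrite -opn_star ustarM ustarB ustar1 su sv; apply: us; rewrite inE.
set M := Num.max _ _.
have M0 : 0 <= M by rewrite le_max qn_ge0.
have MB : M <= B.
  rewrite ge_max; have xB := BP n nN; apply/andP; split.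
    by apply: le_trans (qn_le_opn _ _) xB.
  by apply: le_trans xB; rewrite ler_piMl ?opn_ge0//; lra.
have [key1 key2] := CP n nN p h ph (ltW h0).
set L := (2 * n * 2 ^ m)%N in key1 key2.
have kL : (k <= L)%N by rewrite /k /L leq_mul2r leq_pmulr ?orbT.
have wv : opn (w n * (1 - v)) <= M ^+ k + eta / 2.
  have [|_] := s'P v vc vs (w n).
    by apply/mapP; exists n => //; rewrite mem_iota add0n ltnS.
  move=> H; apply: le_trans H _; apply: lerD; last lra.
  apply: le_trans (qk n) _; apply: lerXn2r; rewrite ?nnegrE ?qn_ge0//.
  by rewrite le_max lexx.
have pL : opn (p ^+ L) <= 1 by exact: opnX_le.
have split3 : w n * p ^+ L = w n * (1 - v) * p ^+ L +
   w n * (v * p ^+ L - ((1 - t) ^+ L)%:C *: v) + ((1 - t) ^+ L)%:C *: (w n * v).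
  rewrite [X in _ + X + _]mulrBr -[w n * (_ *: v)]scalerAr.
  by set a1 := _ *: _; ncring.
have b1 : opn (w n * (1 - v) * p ^+ L) <= M ^+ k + eta / 2.
  apply: le_trans wv; apply: le_trans (opnM _ _) _.
  by rewrite ler_piMr ?opn_ge0.
have b2 : opn (w n * (v * p ^+ L - ((1 - t) ^+ L)%:C *: v)) <= eta / 4.
  apply: le_trans Ch; apply: le_trans (opnM _ _) _.
  apply: (@le_trans _ _ (opn (w n) * (L%:R * h))).
    by rewrite ler_wpM2l ?opn_ge0//; apply: cutoff_power => //; exact: ltW.
  by rewrite mulrA ler_wpM2r// ltW.
have b3 : opn (((1 - t) ^+ L)%:C *: (w n * v)) <= 2 * M ^+ k.
  rewrite opnZ_real; last by rewrite exprn_ge0//; lra.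
  apply: (@le_trans _ _ ((1 - t) ^+ k * (opn (x ^+ n) ^+ k * 2))).
    apply: ler_pM; rewrite ?opn_ge0 ?exprn_ge0//; first lra.
      by apply: ler_wiXn2l => //; lra.
    apply: le_trans (opnM _ _) _; apply: ler_pM; rewrite ?opn_ge0//.
    exact: cutoff_le2 vc.
  rewrite mulrA mulrC ler_wpM2l// -exprMn; apply: lerXn2r.
  - by rewrite nnegrE mulr_ge0 ?opn_ge0//; lra.
  - by rewrite nnegrE.
  - by rewrite le_max lexx orbT.
have total : opn ((x * p) ^+ n) ^+ k <= (M + e) ^+ k.
  apply: le_trans (mP M _); last by rewrite M0.
  apply: le_trans key1 _; rewrite split3.
  have := opnD (w n * (1 - v) * p ^+ L + w n * (v * p ^+ L - ((1 - t) ^+ L)%:C *: v))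
    (((1 - t) ^+ L)%:C *: (w n * v)).
  have := opnD (w n * (1 - v) * p ^+ L) (w n * (v * p ^+ L - ((1 - t) ^+ L)%:C *: v)).
  have : M ^+ k <= (M + e / 2) ^+ k by apply: lerXn2r; rewrite ?nnegrE; lra.
  have : eta <= (M + e / 2) ^+ k by apply: lerXn2r; rewrite ?nnegrE; lra.
  lra.
have k0 : (0 < k)%N by rewrite /k muln_gt0 expn_gt0.
by move: total; rewrite ler_pXn2r// nnegrE ?opn_ge0//; lra.
Qed.

End NormAdjust.

(** * Polynomial approximations of step functions *)

Section CutoffPolynomials.
Context (R : realType).
Implicit Types (m n p q : nat) (k t s y b : R).

Lemma one_sub_pow_le y n : 0 <= y <= 1 -> 1 - (1 - y) ^+ n <= n%:R * y.
Proof.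
move=> y01; elim: n => [|n IH]; first by rewrite expr0 subrr mul0r.
rewrite exprS -natr1; have w0 : 0 <= (1 - y) ^+ n by rewrite exprn_ge0; lra.
have w1 : (1 - y) ^+ n <= 1 by rewrite exprn_ile1; lra.
by move: IH w0 w1; set w := _ ^+ n; nra.
Qed.

(** Rises from 0 to 1 on the scale 1/m. *)
Definition satur m k : R := 1 - (1 - k) ^+ m.
(** Almost 0 below 1/4 and almost 1 above 3/4, exponentially in p. *)
Definition sharp p b : R := 1 - (1 - b ^+ p) ^+ (2 ^ p).

Lemma satur01 m k : 0 <= k <= 1 -> 0 <= satur m k <= 1.
Proof.
move=> k01; have w0 : 0 <= (1 - k) ^+ m by rewrite exprn_ge0; lra.
have w1 : (1 - k) ^+ m <= 1 by rewrite exprn_ile1; lra.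
by rewrite /satur; lra.
Qed.

Lemma satur_le m n k : 0 <= k <= 1 -> (m <= n)%N -> satur m k <= satur n k.
Proof. by move=> k01 mn; rewrite /satur lerD2l lerN2 ler_wiXn2l//; lra. Qed.

Lemma sharp01 p b : 0 <= b <= 1 -> 0 <= sharp p b <= 1.
Proof.
move=> b01; apply: satur01; rewrite exprn_ge0 ?exprn_ile1//; lra.
Qed.

Lemma sharp_small p b : 0 <= b <= 1 -> sharp p b <= (2 * b) ^+ p.
Proof.
move=> b01; rewrite exprMn -natrX; apply: one_sub_pow_le.
by rewrite exprn_ge0 ?exprn_ile1//; lra.
Qed.

Lemma sharp_large p b : 3 / 4 <= b <= 1 -> 1 - sharp p b <= (2 / 3) ^+ p.
Proof.
move=> b34; rewrite /sharp subKr.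
have p0 : (0 : R) <= (3 / 4) ^+ p by rewrite exprn_ge0; lra.
have p1 : ((3 / 4) ^+ p : R) <= 1 by rewrite exprn_ile1; lra.
have bp : (3 / 4) ^+ p <= b ^+ p by apply: lerXn2r; rewrite ?nnegrE; lra.
have b1 : b ^+ p <= 1 by rewrite exprn_ile1; lra.
apply: (@le_trans _ _ ((1 - (3 / 4) ^+ p) ^+ (2 ^ p))).
  by apply: lerXn2r; rewrite ?nnegrE; lra.
have := @bernoulli_inv R ((3 / 4) ^+ p) (2 ^ p)%N; rewrite p0 p1 => /(_ isT).
rewrite natrX -exprMn (_ : 2 * (3 / 4) = (3 / 2 : R)); last by field.
set w := _ ^+ (2 ^ p) => H.
have w0 : 0 <= w by rewrite exprn_ge0//; lra.
have q0 : (0 : R) < (3 / 2) ^+ p by rewrite exprn_gt0//; lra.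
rewrite (_ : 2 / 3 = (3 / 2)^-1 :> R); last by field.
rewrite exprVn -[leRHS]mul1r ler_pdivlMr//; nra.
Qed.

(** The transition takes place at k of order 1/m, whatever p is; p only governs
    how close the values are to 0 and 1. *)
Definition step_fun m p k := sharp p (satur m k).

Lemma step01 m p k : 0 <= k <= 1 -> 0 <= step_fun m p k <= 1.
Proof. by move=> k01; apply/sharp01/satur01. Qed.

(** The factor 5 moves the point where [satur m] takes the value 1/4 to a value
    of [satur M] above 3/4, since (3/4)^5 < 1/4. *)
Lemma step_prod m M p k : 0 <= k <= 1 -> (5 * m <= M)%N ->
  (1 - step_fun M p k) * step_fun m p k <= (2 / 3) ^+ p.
Proof.
move=> k01 mM; have /andP[s0 s1] := step01 m p k01.
have /andP[S0 S1] := step01 M p k01.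
have /andP[b0 b1] := satur01 m k01; have /andP[B0 B1] := satur01 M k01.
have [b4|b4] := leP (satur m k) (1 / 4).
  apply: (@le_trans _ _ (step_fun m p k)); first by rewrite ler_piMl//; lra.
  apply: le_trans (sharp_small _ _) _; first by rewrite b0.
  by apply: lerXn2r; rewrite ?nnegrE; lra.
apply: (@le_trans _ _ (1 - step_fun M p k)); first by rewrite ler_piMr//; lra.
apply: sharp_large; rewrite B1 andbT; apply: le_trans (satur_le k01 mM).
rewrite /satur mulnC exprM.
have w0 : 0 <= (1 - k) ^+ m by rewrite exprn_ge0; lra.
have : ((1 - k) ^+ m) ^+ 5 <= (3 / 4) ^+ 5.
  by apply: lerXn2r; rewrite ?nnegrE; [lra|lra|move: b4; rewrite /satur; lra].
by rewrite (_ : (3 / 4) ^+ 5 = 243 / 1024 :> R); [lra|field].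
Qed.

Lemma step_tail m p t (s : R) : -1 <= t <= 1 -> 0 < s -> (0 < m)%N ->
  3 / m%:R <= s ^+ 4 -> (2 / 3) ^+ p <= s ^+ 2 ->
  (1 - step_fun m p (t ^+ 2)) ^+ 2 * `|t| <= s ^+ 2.
Proof.
move=> t1 s0 m0 ms ps.
have k01 : 0 <= t ^+ 2 <= 1 by rewrite sqr_ge0/=; move: t1 => /andP[]; nra.
have /andP[s00 s01] := step01 m p k01.
have t11 : `|t| <= 1 by rewrite ler_norml.
have [b4|b4] := leP (3 / 4) (satur m (t ^+ 2)).
  have /andP[_ b1] := satur01 m k01.
  have : 1 - step_fun m p (t ^+ 2) <= (2 / 3) ^+ p by apply: sharp_large; rewrite b4.
  set w := 1 - _ => wp; have w0 : 0 <= w by rewrite /w; lra.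
  have w1 : w <= 1 by rewrite /w; lra.
  have := normr_ge0 t; nra.
have m0' : (0 : R) < m%:R by rewrite ltr0n.
have : t ^+ 2 <= s ^+ 4.
  apply: le_trans ms; rewrite ler_pdivlMr//.
  have := bernoulli_inv m k01; move: b4; rewrite /satur.
  have /andP[k0 _] := k01.
  set w := _ ^+ m; set z := t ^+ 2 in k0 *.
  move=> w4 wz; have : 0 <= m%:R * z by rewrite mulr_ge0// ltW.
  nra.
have -> : s ^+ 4 = (s ^+ 2) ^+ 2 by rewrite -exprM.
move=> ts2; have ts : `|t| <= s ^+ 2.
  by rewrite -ler_sqr ?nnegrE ?sqr_ge0// real_normK ?num_real.
apply: le_trans ts; rewrite ler_piMl// exprn_ile1//; lra.
Qed.

(** This bound is uniform in p: it lets the precision of the cut be improved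
    without enlarging the quotient in [step_poly_factor]. *)
Lemma step_lin m p k : 0 <= k <= 1 -> (0 < m)%N -> (0 < p)%N ->
  step_fun m p k <= 2 * m%:R * k.
Proof.
move=> k01 m0 p0; have /andP[s0 s1] := step01 m p k01.
have m0' : (0 : R) < m%:R by rewrite ltr0n.
have [|km] := leP 1 (2 * m%:R * k); first lra.
have /andP[b0 b1] := satur01 m k01; have bk := one_sub_pow_le m k01.
apply: le_trans (sharp_small _ _) _; first by rewrite b0.
have bm : satur m k <= m%:R * k by [].
have bh : satur m k <= 1 / 2.
  by apply: le_trans bm _; move: km; rewrite -mulrA; set z := m%:R * k; lra.
case: p p0 {s0 s1} => // p _; rewrite exprS.
have : (2 * satur m k) ^+ p <= 1 by rewrite exprn_ile1//; lra.
have : 0 <= (2 * satur m k) ^+ p by rewrite exprn_ge0//; lra.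
nra.
Qed.

(** The variable is squared since spectra will lie in [-1, 1]. *)
Definition step_poly m p : {poly R} :=
  1 - (1 - (1 - (1 - 'X ^+ 2) ^+ m) ^+ p) ^+ (2 ^ p).

Lemma step_polyE m p t : (step_poly m p).[t] = step_fun m p (t ^+ 2).
Proof. by rewrite /step_poly /step_fun /sharp /satur !(hornerE, horner_exp). Qed.

Lemma step_poly_factor m p : (0 < m)%N -> (0 < p)%N -> exists2 q : {poly R},
  step_poly m p = 'X * q & forall t, -1 <= t <= 1 -> `|q.[t]| <= 2 * m%:R.
Proof.
move=> m0 p0; have dvd (z : {poly R}) n : exists r, 1 - (1 - z) ^+ n = z * r.
  by rewrite -[X in X - _](expr1n _ n) subrXX subKr; eexists.
have [r1 E1] := dvd ('X ^+ 2) m.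
have [r2 E2] := dvd ((1 - (1 - 'X ^+ 2) ^+ m) ^+ p) (2 ^ p)%N.
set z := 1 - (1 - 'X ^+ 2) ^+ m in E1 E2.
pose r := 'X * r1 * (z ^+ p.-1 * r2).
have E : step_poly m p = 'X * r.
  have zp : z ^+ p = 'X * ('X * r1) * z ^+ p.-1.
    by rewrite -[in LHS](prednK p0) exprS {1}E1 expr2 !mulrA.
  by rewrite /step_poly -/z E2 zp /r !mulrA.
exists r => // t t1; have t11 : `|t| <= 1 by rewrite ler_norml.
have m0' : (0 : R) <= m%:R by [].
have [->|t0] := eqVneq t 0.
  by rewrite /r !hornerE normr0 mulr_ge0.
have tp : 0 < `|t| by rewrite normr_gt0.
have k01 : 0 <= t ^+ 2 <= 1 by rewrite sqr_ge0/=; move: t1 => /andP[]; nra.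
have := step_lin k01 m0 p0; rewrite -step_polyE => H.
have : 0 <= (step_poly m p).[t] by rewrite step_polyE; case/andP: (step01 m p k01).
move: H; rewrite E hornerM hornerX => H H0.
have : `|t| * `|r.[t]| <= 2 * m%:R * t ^+ 2 by rewrite -normrM ger0_norm.
rewrite -(real_normK (num_real t)) expr2 mulrCA ler_pM2l// => H1.
by apply: le_trans H1 _; rewrite ler_piMr// mulr_ge0.
Qed.

End CutoffPolynomials.

(** * Moving towards nilpotent elements *)

Section NilpotentAdjust.
Context (R : realType) (A : cstarAlgType R) (I : ideal A).
Local Notation U := (unitization A).
Implicit Types (X T f g u w : U).

(** [cut m p] is a function of x x^* which is almost 0 near 0 and almost 1 beyond
    a threshold tending to 0 as m grows.  Its factorization through x, with a
    bound that does not involve p, expresses that it is supported away from 0. *)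
Lemma spectral_cut (x : A) (B : R) : 0 < B -> nm x <= B ->
  exists cut : nat -> nat -> U, [/\
    forall m p, opn (cut m p) <= 1 /\ opn (1 - cut m p) <= 1,
    forall m p, (0 < m)%N -> (0 < p)%N ->
      exists2 V, cut m p = inA x * V & opn V <= 2 * m%:R / B,
    forall m M p, (5 * m <= M)%N ->
      opn ((1 - cut M p) * cut m p) <= (2 / 3) ^+ p &
    forall m p s, (0 < m)%N -> 0 < s -> 3 / m%:R <= s ^+ 4 ->
      (2 / 3) ^+ p <= s ^+ 2 -> opn ((1 - cut m p) * inA x) <= B * s].
Proof.
move=> B0 xB; set X := inA x; pose c := B ^- 2.
have c0 : 0 < c by rewrite invr_gt0 exprn_gt0.
pose h : A := c%:C *: cmul x (cstar x).
have hE : inA h = c%:C *: (X * ustar X) by rewrite linearZ/= inAM ustar_inA.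
have sh : cstar h = h.
  by apply: (@inA_inj _ A); rewrite -ustar_inA hE ustarZr ustarM ustarK.
have XB : opn X <= B by rewrite opn_inA.
have h1 : nm h <= 1.
  rewrite -opn_inA hE opnZ_real ?(ltW c0)// opn_Mstar ler_pdivrMl ?exprn_gt0// mulr1.
  by apply: lerXn2r; rewrite ?nnegrE ?opn_ge0 ?(ltW B0).
pose cut m p := pev (step_poly R m p) (inA h).
have scut m p : ustar (cut m p) = cut m p by rewrite ustar_pev// ustar_inA sh.
have t01 (t : R) : -1 <= t <= 1 -> 0 <= t ^+ 2 <= 1.
  by move=> t1; rewrite sqr_ge0/=; move: t1 => /andP[]; nra.
have pos01 (t : R) m p : -1 <= t <= 1 -> 0 <= (step_poly R m p).[t] <= 1.
  by move=> /t01 t1; rewrite step_polyE; exact: step01.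
have compl m p : 1 - cut m p = pev (1 - step_poly R m p) (inA h).
  by rewrite pevB pev1.
have hornerB (m p : nat) (t : R) : (1 - step_poly R m p).[t] = 1 - (step_poly R m p).[t].
  by rewrite hornerD hornerN hornerC.
exists cut; split.
- move=> m p; split.
    by apply: opn_pev => // t /(pos01 _ m p) ?; rewrite ger0_norm; lra.
  rewrite compl; apply: opn_pev => // t /(pos01 _ m p) ?.
  by rewrite hornerB ger0_norm; lra.
- move=> m p m0 p0; have [q qE qb] := @step_poly_factor R m p m0 p0.
  exists (c%:C *: (ustar X * pev q (inA h))).
    by rewrite /cut qE pevM pevX hE -scalerAr -scalerAl mulrA.
  rewrite opnZ_real ?(ltW c0)//; apply: (@le_trans _ _ (c * (B * (2 * m%:R)))).
    rewrite ler_wpM2l ?(ltW c0)//; apply: le_trans (opnM _ _) _.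
    apply: ler_pM; rewrite ?opn_ge0 ?opn_star//; exact: opn_pev.
  by rewrite le_eqVlt; apply/orP; left; apply/eqP; rewrite /c; field; exact: lt0r_neq0.
- move=> m M p mM; rewrite compl -pevM; apply: opn_pev => // t t1.
  have /andP[a0 a1] := pos01 t m p t1; have /andP[b0 b1] := pos01 t M p t1.
  rewrite hornerM hornerB ger0_norm; last by rewrite mulr_ge0//; lra.
  by rewrite !step_polyE; apply: step_prod => //; exact: t01.
- move=> m p s m0 s0 ms ps.
  rewrite -ler_sqr ?nnegrE ?opn_ge0 ?mulr_ge0 ?(ltW B0) ?(ltW s0)//.
  rewrite -opn_Mstar ustarM ustarB ustar1 scut.
  have -> : (1 - cut m p) * X * (ustar X * (1 - cut m p)) =
      (B ^+ 2)%:C *: pev ((1 - step_poly R m p) * 'X * (1 - step_poly R m p)) (inA h).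
    rewrite !pevM pevX -compl hE -scalerAr -scalerAl scalerA -rmorphM/=.
    by rewrite mulfV ?expf_neq0 ?gt_eqF// scale1r !mulrA.
  rewrite opnZ_real ?sqr_ge0// exprMn ler_wpM2l ?sqr_ge0//.
  apply: opn_pev => // t t1; rewrite !hornerM hornerX !hornerB mulrAC -expr2 normrM.
  by rewrite ger0_norm ?sqr_ge0// step_polyE; exact: step_tail.
Qed.

(** The elements fh and gh behave like f and g where u1 and u2 are 1, and like
    f' and g' where they are 0.  As 1 - u2 almost kills u1, the combination of
    f with g', whose product (1 - f) g' need not be small, does not occur. *)
Lemma glue_cutoffs X T g f g' f' (r d : R) :
  0 < d -> 0 <= r ->
  opn g <= 1 -> opn g' <= 1 -> opn f <= 1 -> opn f' <= 1 ->
  opn (1 - g) <= 1 -> opn (1 - g') <= 1 -> opn (1 - f) <= 1 -> opn (1 - f') <= 1 ->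
  opn ((1 - f) * g) <= r -> opn ((1 - f') * g) <= r -> opn ((1 - f') * g') <= r ->
  exists u1 u2, let fh := f * u1 + f' * (1 - u1) in
    let gh := g * u2 + g' * (1 - u2) in
    [/\ cutoff I u1, cutoff I u2,
        opn ((1 - fh) * gh) <= 7 * r + 7 * d,
        opn ((1 - gh) * X) <= 2 * opn ((1 - g) * X) + opn ((1 - g') * X) + 2 * d &
        opn (T * fh) <= 2 * opn (T * f) + qn I (T * f') + 2 * d].
Proof.
move=> d0 r0 g1 g1' f1 f1' cg cg' cf cf' fg fg' f'g'.
have [s Is sP] := @cutoff_qn _ _ I [:: T * f'] _ d0.
have [u1 [c1 s1 F1]] := @quasi_central _ _ I s [:: g; g'] d Is d0.
have Iu1 : forall g, g \in [:: u1] -> inI I g.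
  by move=> v; rewrite inE => /eqP ->; case: c1.
have [u2 [c2 s2 F2]] := @quasi_central _ _ I [:: u1] [:: X] d Iu1 d0.
have [_ su1 cu1] := c1; have [_ su2 cu2] := c2.
have u1n := cutoff_le2 c1; have u2n := cutoff_le2 c2.
have le_prod (P Q : U) (a b : R) : 0 <= a -> 0 <= b ->
    opn P <= a -> opn Q <= b -> opn (P * Q) <= a * b.
  move=> a0 b0 Pa Qb; apply: le_trans (opnM _ _) _.
  by apply: ler_pM; rewrite ?opn_ge0.
have dge0 := ltW d0.
have contr_l (P Q : U) (b : R) : opn P <= 1 -> opn Q <= b -> opn (P * Q) <= b.
  move=> P1; apply: le_trans; apply: le_trans (opnM _ _) _.
  by rewrite ler_piMl ?opn_ge0.
have contr_r (P Q : U) (b : R) : opn Q <= 1 -> opn P <= b -> opn (P * Q) <= b.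
  move=> Q1; apply: le_trans; apply: le_trans (opnM _ _) _.
  by rewrite ler_piMr ?opn_ge0.
have k1 : opn (u1 * g - g * u1) <= d by apply: F1; rewrite inE eqxx.
have k1' : opn (u1 * g' - g' * u1) <= d by apply: F1; rewrite !inE eqxx orbT.
have k2 : opn (u2 * X - X * u2) <= d by apply: F2; rewrite inE.
have u12 : opn ((1 - u2) * u1) <= d by apply: s2; rewrite inE.
have u12' : opn (u1 * (1 - u2)) <= d.
  by rewrite -opn_star ustarM ustarB ustar1 su1 su2.
have Tu : opn (T * f' * (1 - u1)) <= qn I (T * f') + 2 * d.
  by have [|] := sP u1 c1 s1 (T * f'); rewrite ?inE.
exists u1, u2; move=> /=; split => //.
- have -> : (1 - (f * u1 + f' * (1 - u1))) * (g * u2 + g' * (1 - u2)) =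
     ((1 - f) * g * (u1 * u2) + (1 - f) * (u1 * g - g * u1) * u2) +
     ((1 - f) * g' * (u1 * (1 - u2)) + (1 - f) * (u1 * g' - g' * u1) * (1 - u2)) +
     (((1 - f') * g * ((1 - u1) * u2) - (1 - f') * (u1 * g - g * u1) * u2) +
     ((1 - f') * g' * ((1 - u1) * (1 - u2)) - (1 - f') * (u1 * g' - g' * u1) * (1 - u2))).
    by ncring.
  have e1 : opn ((1 - f) * g * (u1 * u2)) <= r * (2 * 2).
    by apply: (le_prod) => //; apply: (le_prod).
  have e2 : opn ((1 - f) * (u1 * g - g * u1) * u2) <= d * 2.
    by apply: (le_prod) => //; apply: (contr_l).
  have e3 : opn ((1 - f) * g' * (u1 * (1 - u2))) <= d.
    by apply: (contr_l) => //; apply: (contr_l).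
  have e4 : opn ((1 - f) * (u1 * g' - g' * u1) * (1 - u2)) <= d.
    by apply: (contr_r) => //; apply: (contr_l).
  have e5 : opn ((1 - f') * g * ((1 - u1) * u2)) <= r * 2.
    by apply: (le_prod) => //; apply: (contr_l).
  have e6 : opn (- ((1 - f') * (u1 * g - g * u1) * u2)) <= d * 2.
    by rewrite opnN; apply: (le_prod) => //; apply: (contr_l).
  have e7 : opn ((1 - f') * g' * ((1 - u1) * (1 - u2))) <= r.
    by apply: (contr_r) => //; apply: (contr_l).
  have e8 : opn (- ((1 - f') * (u1 * g' - g' * u1) * (1 - u2))) <= d.
    by rewrite opnN; apply: (contr_r) => //; apply: (contr_l).
  have tri (P Q : U) (a b : R) : opn P <= a -> opn Q <= b -> opn (P + Q) <= a + b.
    by move=> Pa Qb; apply: le_trans (opnD _ _) _; exact: lerD.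
  have := tri _ _ _ _ (tri _ _ _ _ (tri _ _ _ _ e1 e2) (tri _ _ _ _ e3 e4))
    (tri _ _ _ _ (tri _ _ _ _ e5 e6) (tri _ _ _ _ e7 e8)).
  move/le_trans; apply; rewrite le_eqVlt; apply/orP; left; apply/eqP; ring.
- have -> : (1 - (g * u2 + g' * (1 - u2))) * X =
    ((1 - g) * X * u2 + (1 - g') * X * (1 - u2)) +
    ((1 - g) * (u2 * X - X * u2) + - ((1 - g') * (u2 * X - X * u2))) by ncring.
  have e1 : opn ((1 - g) * X * u2) <= opn ((1 - g) * X) * 2.
    by apply: (le_prod) => //; exact: opn_ge0.
  have e2 : opn ((1 - g') * X * (1 - u2)) <= opn ((1 - g') * X).
    exact: (contr_r).
  have e3 : opn ((1 - g) * (u2 * X - X * u2)) <= d by exact: (contr_l).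
  have e4 : opn (- ((1 - g') * (u2 * X - X * u2))) <= d.
    by rewrite opnN; exact: (contr_l).
  apply: le_trans (opnD _ _) _.
  have := opnD ((1 - g) * X * u2) ((1 - g') * X * (1 - u2)).
  have := opnD ((1 - g) * (u2 * X - X * u2)) (- ((1 - g') * (u2 * X - X * u2))).
  by move: e1 e2 e3 e4; clear; lra.
- rewrite mulrDr !mulrA; apply: le_trans (opnD _ _) _.
  have : opn (T * f * u1) <= opn (T * f) * 2 by apply: (le_prod) => //; exact: opn_ge0.
  by move: Tu; clear; lra.
Qed.

(** To treat [opn] and [qn] at once. *)
Record submul_seminorm (nu : U -> R) : Prop := SubmulSeminorm {
  snu0 : nu 0 = 0;
  snu_ge0 : forall T, 0 <= nu T;
  snuN : forall T, nu (- T) = nu T;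
  snuD : forall S T, nu (S + T) <= nu S + nu T;
  snuM : forall S T, nu (S * T) <= nu S * nu T
}.

Lemma submul_opn : submul_seminorm (@opn R A).
Proof. split; [exact: opn0|exact: opn_ge0|exact: opnN|exact: opnD|exact: opnM]. Qed.

Lemma submul_qn : submul_seminorm (qn I).
Proof.
split; [|exact: qn_ge0|exact: qnN|exact: qnD|exact: qnM].
by apply/le_anti; rewrite qn_ge0 andbT -[leRHS](@opn0 R A) qn_le_opn.
Qed.

(** In (g X f)^n each inner f g may be replaced by g, and g X by X. *)
Lemma power_compress (B : R) n : 0 <= B -> exists2 K : R, 0 <= K &
  forall nu X f g e, submul_seminorm nu -> nu X <= B -> nu f <= 3 -> nu g <= 3 ->
    0 <= e -> nu ((1 - g) * X) <= e -> nu ((1 - f) * g) <= e ->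
    nu ((g * X * f) ^+ n.+1 - g * X ^+ n.+1 * f) <= K * e.
Proof.
move=> B0; elim: n => [|n [K K0 IH]].
  by exists 0 => // nu X f g e [nu0 *]; rewrite !expr1 subrr mul0r nu0.
exists (K * (3 * B * 3) + (3 * B ^+ n.+1 * 3 + 3 * B ^+ n.+1 * (B * 3))).
  by rewrite !(addr_ge0, mulr_ge0, exprn_ge0).
move=> nu X f g e nuP XB f3 g3 e0 gX fg; have [_ nu0 nuN nuD nuM] := nuP.
have le_prod (P Q : U) (a b : R) : nu P <= a -> nu Q <= b -> nu (P * Q) <= a * b.
  move=> Pa Qb; apply: le_trans (nuM _ _) _.
  by apply: ler_pM; rewrite ?nu0.
have := IH nu X f g e nuP XB f3 g3 e0 gX fg; set Y := g * X * f => H.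
have -> : Y ^+ n.+2 - g * X ^+ n.+2 * f =
   (Y ^+ n.+1 - g * X ^+ n.+1 * f) * Y +
   - (g * X ^+ n.+1 * (((1 - g) * X) * f) + g * X ^+ n.+1 * ((1 - f) * g * (X * f))).
  rewrite [Y ^+ n.+2]exprSr [X ^+ n.+2]exprSr.
  by rewrite [in RHS]/Y; set P := Y ^+ _; set Q := X ^+ _; rewrite /Y; ncring.
have XnB : nu (X ^+ n.+1) <= B ^+ n.+1.
  elim: (n) => [|j IHj]; first by rewrite !expr1.
  by rewrite exprS [leRHS]exprS; exact: le_prod.
apply: le_trans (nuD _ _) _; rewrite nuN [leRHS]mulrDl; apply: lerD.
  by rewrite mulrAC; apply: (le_prod) => //; do !apply: (le_prod).
apply: le_trans (nuD _ _) _; rewrite [leRHS]mulrDl; apply: lerD.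
  have -> : 3 * B ^+ n.+1 * 3 * e = (3 * B ^+ n.+1) * (e * 3) by ring.
  by do !apply: (le_prod).
have -> : 3 * B ^+ n.+1 * (B * 3) * e = (3 * B ^+ n.+1) * (e * (B * 3)) by ring.
by do !apply: (le_prod).
Qed.

Lemma exists_geom (d : R) : 0 < d -> exists2 p, (0 < p)%N & (2 / 3) ^+ p <= d.
Proof.
move=> d0; pose p := (Num.bound (3 / d)).+1; exists p => //.
have := @bernoulli_inv R (1 / 3) p; rewrite (_ : 1 - 1 / 3 = 2 / 3 :> R); last by field.
move=> /(_ ltac:(lra)); set w := _ ^+ p => H.
have pd : 3 / d < p%:R.
  apply: lt_le_trans (archi_boundP _) _; first by rewrite divr_ge0// ltW.
  by rewrite ler_nat.
move: pd; rewrite ltr_pdivrMr// => pd.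
have w0 : 0 <= w by rewrite exprn_ge0//; lra.
have : w * (p%:R * d) <= 3 * d by nra.
have : w * 3 <= w * (p%:R * d) by rewrite ler_wpM2l//; lra.
lra.
Qed.

Lemma exists_inv_nat (d : R) n0 : 0 < d -> exists m, [/\ (0 < m)%N, (n0 <= m)%N & 3 / m%:R <= d].
Proof.
move=> d0; pose m := (Num.bound (3 / d) + n0).+1; exists m; split => //.
  exact/leqW/leq_addl.
rewrite ler_pdivrMr ?ltr0n// mulrC -ler_pdivrMr//.
apply/ltW/(lt_le_trans (archi_boundP _)); first by rewrite divr_ge0// ltW.
by rewrite ler_nat /m -addnS leq_addr.
Qed.

(** A coarse cut of x, on the scale 1/m, which is a fine cut modulo I, on the
    scale 1/m'.  The compression gh x fh has a small k-th power if x^(k+1) is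
    small and even smaller modulo I. *)
Lemma cut_once (x : A) k (B s s' e : R) m m' : 0 < B -> nm x <= B ->
  0 < s' -> s' <= s -> (0 < m)%N -> (5 * m <= m')%N ->
  3 / m%:R <= s ^+ 4 -> 3 / m'%:R <= s' ^+ 4 -> 0 < e -> e <= B * s' ->
  exists fh gh V, [/\
    [/\ gh = inA x * V, opn V <= (4 * m%:R + 2 * m'%:R) / B, opn fh <= 3 & opn gh <= 3],
    opn ((1 - fh) * gh) <= e,
    opn ((1 - gh) * inA x) <= 4 * B * s /\ qn I ((1 - gh) * inA x) <= B * s',
    opn (inA x ^+ k * fh) <= 20 * m%:R / B * opn (inA x ^+ k.+1)
        + 10 * m'%:R / B * qn I (inA x ^+ k.+1) + e &
    qn I (inA x ^+ k * fh) <= 10 * m'%:R / B * qn I (inA x ^+ k.+1)].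
Proof.
move=> B0 xB s'0 ss m0 mm ms ms' e0 eB; set X := inA x.
have s0 := lt_le_trans s'0 ss.
have m'0 : (0 < m')%N by apply: leq_trans mm; rewrite muln_gt0.
have [cut [cut1 cutV cutP cutX]] := spectral_cut B0 xB.
have [p p0 pP] : exists2 p, (0 < p)%N &
    (2 / 3) ^+ p <= Num.min (e / 14) (Num.min (s ^+ 2) (s' ^+ 2)) :> R.
  by apply: exists_geom; rewrite !lt_min !exprn_gt0// divr_gt0.
move: pP; rewrite !le_min => /and3P[pe ps ps'].
have [V0 gV V0b] := cutV m p m0 p0; have [V1 gV' V1b] := cutV m' p m'0 p0.
have M0 : (0 < 5 * m)%N by rewrite muln_gt0.
have M'0 : (0 < 5 * m')%N by rewrite muln_gt0.
have [V2 fV V2b] := cutV _ p M0 p0; have [V3 fV' V3b] := cutV _ p M'0 p0.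
have gX := cutX m p s m0 s0 ms ps; have gX' := cutX m' p s' m'0 s'0 ms' ps'.
have r0 : (0 : R) <= (2 / 3) ^+ p by rewrite exprn_ge0//; lra.
have d0 : 0 < e / 14 by rewrite divr_gt0.
have m5m : (5 * m <= 5 * m')%N by rewrite leq_mul2l/= (leq_trans _ mm)// leq_pmull.
have [g1 cg] := cut1 m p; have [g1' cg'] := cut1 m' p.
have [f1 cf] := cut1 (5 * m)%N p; have [f1' cf'] := cut1 (5 * m')%N p.
have := @glue_cutoffs X (X ^+ k) (cut m p) (cut (5 * m)%N p) (cut m' p)
  (cut (5 * m')%N p) _ _ d0 r0 g1 g1' f1 f1' cg cg' cf cf'
  (cutP _ _ _ (leqnn _)) (cutP _ _ _ m5m) (cutP _ _ _ (leqnn _)).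
move=> [u1 [u2]] /=.
set g := cut m p in gV gX g1 cg *; set g' := cut m' p in gV' gX' g1' cg' *.
set f := cut (5 * m)%N p in fV f1 cf *; set f' := cut (5 * m')%N p in fV' f1' cf' *.
set fh := f * u1 + _; set gh := g * u2 + _ => -[c1 c2 zP gXP TP].
have u1n := cutoff_le2 c1; have u2n := cutoff_le2 c2.
have [Iu1 _ cu1] := c1; have [Iu2 _ cu2] := c2.
have three (P Q v : U) : opn P <= 1 -> opn Q <= 1 -> opn v <= 2 -> opn (1 - v) <= 1 ->
    opn (P * v + Q * (1 - v)) <= 3.
  move=> P1 Q1 v2 v1; apply: le_trans (opnD _ _) _.
  apply: (@le_trans _ _ (1 * 2 + 1 * 1)); last lra.
  by apply: lerD; apply: le_trans (opnM _ _) _; apply: ler_pM; rewrite ?opn_ge0.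
have Xf : opn (X ^+ k * f) <= 10 * m%:R / B * opn (X ^+ k.+1).
  rewrite fV mulrA -exprSr mulrC; apply: le_trans (opnM _ _) _.
  rewrite ler_wpM2l ?opn_ge0//; apply: le_trans V2b _.
  by rewrite natrM mulrA -natrM.
have Xf' : qn I (X ^+ k * f') <= 10 * m'%:R / B * qn I (X ^+ k.+1).
  rewrite fV' mulrA -exprSr mulrC; apply: le_trans (qnM _ _ _) _.
  rewrite ler_wpM2l ?qn_ge0//; apply: le_trans (qn_le_opn _ _) _.
  by apply: le_trans V3b _; rewrite natrM mulrA -natrM.
exists fh, gh, (V0 * u2 + V1 * (1 - u2)); split.
- split; [|
    |exact: three|exact: three].
    by rewrite mulrDr !mulrA -gV -gV'.
  apply: le_trans (opnD _ _) _.
  apply: (@le_trans _ _ (2 * m%:R / B * 2 + 2 * m'%:R / B * 1)); last first.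
    by rewrite le_eqVlt; apply/orP; left; apply/eqP; field; exact: lt0r_neq0.
  by apply: lerD; apply: le_trans (opnM _ _) _; apply: ler_pM; rewrite ?opn_ge0.
- by apply: le_trans zP _; move: pe; clear; lra.
- split.
    apply: le_trans gXP _; have : B * s' <= B * s by rewrite ler_pM2l.
    have : 0 < B * s' by rewrite mulr_gt0.
    by move: gX gX' eB; rewrite -!/X; clear; lra.
  rewrite (@qn_congr _ _ _ _ ((1 - g') * X)).
    by apply: le_trans (qn_le_opn _ _) _.
  have -> : (1 - gh) * X - (1 - g') * X = - ((g - g') * u2 * X) by rewrite /gh; ncring.
  by apply/inIN/inIMr/inIMl.
- apply: le_trans TP _; move: Xf Xf' (opn_ge0 (X ^+ k.+1)) e0.
  rewrite -!mulrA; set a := m%:R * _; set b := m'%:R * _; clear; lra.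
- rewrite (@qn_congr _ _ _ _ (X ^+ k * f'))//.
  have -> : X ^+ k * fh - X ^+ k * f' = X ^+ k * (f - f') * u1 by rewrite /fh; ncring.
  exact: inIMl.
Qed.

(** If X = a + b and a X = 0, then X^(n+1) = b^n X. *)
Lemma triangular_power (X a b : U) (c e : R) n : X = a + b -> 1 <= c -> 0 <= e ->
  opn b <= c -> opn X <= c -> opn (a * X) <= e ->
  opn (X ^+ n.+1 - b ^+ n * X) <= n%:R * c ^+ n * e.
Proof.
move=> XE c1 e0 bc Xc aX; have c0 : 0 <= c by lra.
elim: n => [|n IH]; first by rewrite expr1 mul1r subrr opn0 !mul0r.
have -> : X ^+ n.+2 - b ^+ n.+1 * X =
    a * X * X ^+ n + b * (X ^+ n.+1 - b ^+ n * X).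
  rewrite exprS (exprS b) (exprS X n) {1}XE; set P := X ^+ n; set Q := b ^+ n; ncring.
have Xn : opn (X ^+ n) <= c ^+ n by exact: opnX_bound.
apply: le_trans (opnD _ _) _.
apply: (@le_trans _ _ (e * c ^+ n + c * (n%:R * c ^+ n * e))).
  by apply: lerD; apply: le_trans (opnM _ _) _; apply: ler_pM; rewrite ?opn_ge0.
have cn0 : 0 <= c ^+ n by rewrite exprn_ge0.
have : e * c ^+ n <= c * (e * c ^+ n) by rewrite ler_peMl// mulr_ge0.
rewrite exprS -natr1; set z := c ^+ n; set t := n%:R; nra.
Qed.

(** Induction on the order of nilpotency, the induction hypothesis being applied
    to x1 = gh x fh.  The new element is x w = gh x (1 - fh) + x1 w1; the form
    x1 w1 ensures that 1 - fh almost kills both terms.  The order of the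
    quantifiers matters: the coarse scale depends only on D, the fine one only
    on D and D', and the precision e is chosen last, when x, the scales and the
    bound W are fixed. *)
Lemma nilpotent_adjust n (B D : R) : 0 < B -> 0 < D ->
  exists2 b : R, 0 < b & forall D' : R, 0 < D' -> exists b' W : R, [/\ 0 < b', 0 <= W &
  forall x : A, nm x <= B -> opn (inA x ^+ n.+1) <= b ->
    qn I (inA x ^+ n.+1) <= b' -> forall e : R, 0 < e -> exists w : U,
    [/\ opn w <= W, opn (inA x * w - inA x) <= D,
        qn I (inA x * w - inA x) <= D' & opn ((inA x * w) ^+ n.+1) <= e]].
Proof.
elim: n B D => [|n IH] B D B0 D0.
  exists D => // D' D'0; exists D', 0; split => // x _; rewrite expr1 => xb xb' e e0.
  exists 0; rewrite mulr0 sub0r opnN qnN expr1 opn0; split => //; exact: ltW.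
have B9 : 0 < 9 * B by lra.
have D2 : 0 < D / 2 by lra.
have [b1 b10 IHb] := IH (9 * B) (D / 2) B9 D2.
have [K K0 KP] := @power_compress B n (ltW B0).
have K1 : 0 < K + 1 by lra.
pose s := Num.min (D / (8 * B)) (b1 / (12 * B * (K + 1))).
have s0 : 0 < s by rewrite lt_min !divr_gt0 ?mulr_gt0.
have sD : 4 * B * s <= D / 2.
  have : s <= D / (8 * B) by rewrite ge_min lexx.
  by rewrite ler_pdivlMr ?mulr_gt0// => ?; lra.
have sb : K * (4 * B * s) <= b1 / 3.
  have : s <= b1 / (12 * B * (K + 1)) by rewrite ge_min lexx orbT.
  rewrite ler_pdivlMr ?mulr_gt0// => sK.
  have : 0 <= 4 * B * s by rewrite !mulr_ge0// ltW.
  by move: sK; clear; nra.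
have s40 : 0 < s ^+ 4 by rewrite exprn_gt0.
have [m [m0 _ ms]] := exists_inv_nat 0 s40.
have mR : 0 < m%:R :> R by rewrite ltr0n.
(* makes the first term of the bound in [cut_once] at most b1 / 9 *)
exists (b1 * B / (180 * m%:R)); first by rewrite divr_gt0 ?mulr_gt0.
move=> D' D'0; have D'2 : 0 < D' / 2 by lra.
have [b1' [W1 [b1'0 W10 IHb']]] := IHb (D' / 2) D'2.
pose s' := Num.min s (Num.min (D' / (2 * B)) (b1' / (2 * B * (K + 1)))).
have s'0 : 0 < s' by rewrite lt_min s0 lt_min !divr_gt0 ?mulr_gt0.
have s's : s' <= s by rewrite ge_min lexx.
have sD' : B * s' <= D' / 2.
  have : s' <= D' / (2 * B) by rewrite !ge_min lexx !orbT.
  by rewrite ler_pdivlMr ?mulr_gt0// => ?; lra.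
have sb' : K * (B * s') <= b1' / 2.
  have : s' <= b1' / (2 * B * (K + 1)) by rewrite !ge_min lexx !orbT.
  rewrite ler_pdivlMr ?mulr_gt0// => sK.
  have : 0 <= B * s' by rewrite !mulr_ge0// ltW.
  by move: sK; clear; nra.
have s'40 : 0 < s' ^+ 4 by rewrite exprn_gt0.
have [m' [m'0 mm' ms']] := exists_inv_nat (5 * m) s'40.
have m'R : 0 < m'%:R :> R by rewrite ltr0n.
pose b' := B * Num.min b1 b1' / (180 * m'%:R).
have b'0 : 0 < b' by rewrite divr_gt0 ?mulr_gt0// lt_min b10.
pose Y := B * (4 + 3 * W1).
have Y0 : 0 < Y by rewrite mulr_gt0//; lra.
exists b', ((4 * m%:R + 2 * m'%:R) / B * Y); split => //.
  by rewrite mulr_ge0 ?divr_ge0 ?(ltW Y0) ?(ltW B0)// addr_ge0.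
move=> x xB xb xb' e e0; set X := inA x.
pose c := 1 + 3 * Y; have c1 : 1 <= c by rewrite /c; lra.
pose G := n.+1%:R * c ^+ n.+1 * (3 * B * Y).
have G0 : 0 <= G.
  have c0 : 0 <= c := le_trans ler01 c1.
  by apply: mulr_ge0; apply: mulr_ge0 => //; [exact: exprn_ge0|rewrite mulr_ge0// ltW|exact: ltW].
have G1 : 0 < 2 * (G + 1) by lra.
pose e0' := Num.min (B * s') (Num.min (b1 / 36) (e / (2 * (G + 1)))).
have e0'0 : 0 < e0' by rewrite !lt_min mulr_gt0//= !divr_gt0.
have eBs : e0' <= B * s' by rewrite ge_min lexx.
have eb : e0' <= b1 / 36 by rewrite !ge_min lexx !orbT.
have eG : G * e0' <= e / 2.
  have : e0' <= e / (2 * (G + 1)) by rewrite !ge_min lexx !orbT.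
  by rewrite ler_pdivlMr// => eG; move: e0'0 eG; clear; nra.
have [fh [gh [V [[ghV Vb f3 g3] zP [gX qX] Tf qf]]]] :=
  cut_once n.+1 B0 xB s'0 s's m0 mm' ms ms' e0'0 eBs.
have XB : opn X <= B by rewrite opn_inA.
have qXB : qn I X <= B := le_trans (qn_le_opn _ _) XB.
have qf3 : qn I fh <= 3 := le_trans (qn_le_opn _ _) f3.
have qg3 : qn I gh <= 3 := le_trans (qn_le_opn _ _) g3.
have qz : qn I ((1 - fh) * gh) <= B * s'.
  by apply: le_trans (qn_le_opn _ _) _; apply: le_trans zP _.
have e4 : e0' <= 4 * B * s.
  apply: le_trans eBs _; have : B * s' <= B * s by rewrite ler_pM2l.
  have : 0 < B * s' by rewrite mulr_gt0.
  by clear; lra.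
have Bs0 : 0 <= 4 * B * s by rewrite !mulr_ge0// ltW.
have P1 := KP _ X fh gh _ submul_opn XB f3 g3 Bs0 gX (le_trans zP e4).
have Bs'0 : 0 <= B * s' by rewrite mulr_ge0// ltW.
have P2 := KP _ X fh gh _ submul_qn qXB qf3 qg3 Bs'0 qX qz.
set x1U := gh * X * fh in P1 P2.
have [x1 x1E] : exists x1, x1U = inA x1.
  by rewrite /x1U -inAMr -inAMl; eexists.
have mb : 20 * m%:R / B * opn (X ^+ n.+2) <= b1 / 9.
  apply: (@le_trans _ _ (20 * m%:R / B * (b1 * B / (180 * m%:R)))).
    by rewrite ler_wpM2l// divr_ge0 ?mulr_ge0// ltW.
  rewrite le_eqVlt; apply/orP; left; apply/eqP; field.
  by rewrite !lt0r_neq0.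
have mb' : 10 * m'%:R / B * qn I (X ^+ n.+2) <= Num.min b1 b1' / 18.
  apply: (@le_trans _ _ (10 * m'%:R / B * b')).
    by rewrite ler_wpM2l// divr_ge0 ?mulr_ge0// ltW.
  rewrite le_eqVlt; apply/orP; left; apply/eqP; rewrite /b'; field.
  by rewrite !lt0r_neq0.
have minb : Num.min b1 b1' <= b1 by rewrite ge_min lexx.
have minb' : Num.min b1 b1' <= b1' by rewrite ge_min lexx orbT.
have x1B : opn x1U <= 9 * B.
  apply: le_trans (opnM _ _) _; rewrite (_ : 9 * B = 3 * B * 3); last by ring.
  apply: ler_pM; rewrite ?opn_ge0//; apply: le_trans (opnM _ _) _.
  by apply: ler_pM; rewrite ?opn_ge0.
have Q1 : opn (x1U ^+ n.+1) <= b1.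
  rewrite -(subrK (gh * X ^+ n.+1 * fh) (x1U ^+ n.+1)).
  apply: le_trans (opnD _ _) _.
  have : opn (gh * X ^+ n.+1 * fh) <= 3 * opn (X ^+ n.+1 * fh).
    rewrite -mulrA; apply: le_trans (opnM _ _) _.
    by rewrite ler_wpM2r ?opn_ge0.
  by move: Tf P1 sb mb mb' minb eb b10; rewrite -/X; clear; lra.
have Q2 : qn I (x1U ^+ n.+1) <= b1'.
  rewrite -(subrK (gh * X ^+ n.+1 * fh) (x1U ^+ n.+1)).
  apply: le_trans (qnD _ _ _) _.
  have : qn I (gh * X ^+ n.+1 * fh) <= 3 * qn I (X ^+ n.+1 * fh).
    rewrite -mulrA; apply: le_trans (qnM _ _ _) _.
    by rewrite ler_wpM2r ?qn_ge0.
  by move: qf P2 sb' mb' minb' b1'0; rewrite -/X; clear; lra.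
have c20 : 0 < e / (2 * c) by rewrite divr_gt0// mulr_gt0// (lt_le_trans _ c1).
rewrite x1E in x1B Q1 Q2; rewrite opn_inA in x1B.
have [w1 [w1W w1D w1D' w1e]] := IHb' x1 x1B Q1 Q2 _ c20.
rewrite -x1E in w1D w1D' w1e Q1 Q2.
pose Z := X * (1 - fh) + X * fh * w1.
have ZY : opn Z <= Y.
  apply: le_trans (opnD _ _) _.
  have f4 : opn (1 - fh) <= 4.
    by apply: le_trans (opnD _ _) _; rewrite opnN; have := opn1 A; move: f3; clear; lra.
  have -> : Y = B * 4 + B * 3 * W1 by rewrite /Y; ring.
  apply: lerD; apply: le_trans (opnM _ _) _; apply: ler_pM; rewrite ?opn_ge0//.
  by apply: le_trans (opnM _ _) _; apply: ler_pM; rewrite ?opn_ge0.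
have xw : X * (V * Z) = gh * Z by rewrite mulrA -ghV.
have gZ : gh * Z = gh * X * (1 - fh) + x1U * w1 by rewrite /Z /x1U; ncring.
exists (V * Z); rewrite -/X; split.
- by apply: le_trans (opnM _ _) _; apply: ler_pM; rewrite ?opn_ge0.
- have -> : X * (V * Z) - X = - ((1 - gh) * X) + (x1U * w1 - x1U).
    by rewrite xw gZ /x1U; ncring.
  apply: le_trans (opnD _ _) _; rewrite opnN.
  by move: gX sD w1D; rewrite -/X; clear; lra.
- have -> : X * (V * Z) - X = - ((1 - gh) * X) + (x1U * w1 - x1U).
    by rewrite xw gZ /x1U; ncring.
  apply: le_trans (qnD _ _ _) _; rewrite qnN.
  by move: qX sD' w1D'; rewrite -/X; clear; lra.
have gZc : opn (gh * Z) <= c.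
  apply: (@le_trans _ _ (3 * Y)); last by rewrite /c lerDr.
  by apply: le_trans (opnM _ _) _; apply: ler_pM; rewrite ?opn_ge0.
have xwc : opn (x1U * w1) <= c.
  apply: (@le_trans _ _ (3 * (B * (3 * W1)))); last first.
    rewrite /c /Y; have : 0 <= B by rewrite ltW.
    have : 0 <= B * W1 by rewrite mulr_ge0// ltW.
    by clear; lra.
  have fw : opn (fh * w1) <= 3 * W1.
    by apply: le_trans (opnM _ _) _; apply: ler_pM; rewrite ?opn_ge0.
  have Xfw : opn (X * (fh * w1)) <= B * (3 * W1).
    by apply: le_trans (opnM _ _) _; apply: ler_pM; rewrite ?opn_ge0.
  rewrite /x1U -mulrA -mulrA; apply: le_trans (opnM _ _) _.
  by apply: ler_pM; rewrite ?opn_ge0.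
have azP : opn (gh * X * (1 - fh) * (gh * Z)) <= 3 * B * Y * e0'.
  have -> : gh * X * (1 - fh) * (gh * Z) = gh * X * (((1 - fh) * gh) * Z) by rewrite !mulrA.
  have -> : 3 * B * Y * e0' = (3 * B) * (e0' * Y) by ring.
  have gX3 : opn (gh * X) <= 3 * B.
    by apply: le_trans (opnM _ _) _; apply: ler_pM; rewrite ?opn_ge0.
  have zZ : opn ((1 - fh) * gh * Z) <= e0' * Y.
    by apply: le_trans (opnM _ _) _; apply: ler_pM; rewrite ?opn_ge0.
  by apply: le_trans (opnM _ _) _; apply: ler_pM; rewrite ?opn_ge0.
rewrite xw; have ee0 : 0 <= 3 * B * Y * e0'.
  apply: mulr_ge0; last exact: ltW.
  by apply: mulr_ge0; [apply: mulr_ge0 => //|]; exact: ltW.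
have := triangular_power n.+1 gZ c1 ee0 xwc gZc azP.
have -> : n.+1%:R * c ^+ n.+1 * (3 * B * Y * e0') = G * e0' by rewrite /G; ring.
move=> TP.
rewrite -(subrK ((x1U * w1) ^+ n.+1 * (gh * Z)) ((gh * Z) ^+ n.+2)).
apply: le_trans (opnD _ _) _.
have : opn ((x1U * w1) ^+ n.+1 * (gh * Z)) <= e / 2.
  have -> : e / 2 = e / (2 * c) * c.
    by field; rewrite lt0r_neq0// (lt_le_trans _ c1).
  by apply: le_trans (opnM _ _) _; apply: ler_pM; rewrite ?opn_ge0.
by move: TP eG; clear; lra.
Qed.

End NilpotentAdjust.

(** * Lifting with norm control *)

Section Lifting.
Context (R : realType) (A : cstarAlgType R) (I : ideal A).
Local Notation U := (unitization A).
Implicit Types (S T : U).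

Lemma opn_powB S T (c d : R) n : 1 <= c -> opn S <= c -> opn T <= c ->
  opn (S - T) <= d -> opn (S ^+ n - T ^+ n) <= n%:R * c ^+ n * d.
Proof.
move=> c1 Sc Tc STd; have c0 : 0 <= c := le_trans ler01 c1.
have d0 : 0 <= d := le_trans (opn_ge0 _) STd.
elim: n => [|n IH]; first by rewrite subrr opn0 !mul0r.
have -> : S ^+ n.+1 - T ^+ n.+1 = S * (S ^+ n - T ^+ n) + (S - T) * T ^+ n.
  by rewrite !exprS; set P := S ^+ n; set Q := T ^+ n; ncring.
apply: le_trans (opnD _ _) _.
apply: (@le_trans _ _ (c * (n%:R * c ^+ n * d) + d * c ^+ n)).
  apply: lerD; apply: le_trans (opnM _ _) _; apply: ler_pM; rewrite ?opn_ge0//.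
  exact: opnX_bound.
have : d * c ^+ n <= c * (d * c ^+ n) by rewrite ler_peMl// mulr_ge0// exprn_ge0.
rewrite exprS -natr1; set z := c ^+ n; set t := n%:R; nra.
Qed.

Lemma inI_powB S T n : inI I (S - T) -> inI I (S ^+ n - T ^+ n).
Proof.
move=> ST; elim: n => [|n IH]; first by rewrite subrr; exact: inI0.
have -> : S ^+ n.+1 - T ^+ n.+1 = S * (S ^+ n - T ^+ n) + (S - T) * T ^+ n.
  by rewrite !exprS; set P := S ^+ n; set Q := T ^+ n; ncring.
by apply: inID; [exact: inIMl|exact: inIMr].
Qed.

(** The element x w of [nilpotent_adjust] is a lift only up to D', which can be
    taken so small that restoring the class modulo I does not spoil the
    estimates. *)
Lemma nilpotent_lift_adjust n (B D : R) : 0 < B -> 0 < D ->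
  exists2 b : R, 0 < b & forall x : A, nm x <= B -> opn (inA x ^+ n.+1) <= b ->
    qn I (inA x ^+ n.+1) = 0 -> forall e : R, 0 < e -> exists x' : A,
    [/\ inI I (inA x' - inA x), opn (inA x' - inA x) <= D &
        opn (inA x' ^+ n.+1) <= e].
Proof.
move=> B0 D0; have D2 : 0 < D / 2 by lra.
have [b b0 bP] := nilpotent_adjust I n B0 D2.
exists b => // x xB xb xq e e0; set X := inA x in xb xq *.
pose c := 1 + B + D; have c1 : 1 <= c by rewrite /c; lra.
have c0 : 0 < c := lt_le_trans ltr01 c1.
pose G := n.+1%:R * c ^+ n.+1.
have G0 : 0 <= G by rewrite mulr_ge0// exprn_ge0// ltW.
pose D' := Num.min (D / 4) (e / (4 * (G + 1))).
have G1 : 0 < 4 * (G + 1) by rewrite mulr_gt0// ltr_wpDl.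
have D'0 : 0 < D' by rewrite lt_min !divr_gt0.
have D'D : D' <= D / 4 by rewrite ge_min lexx.
have D'e : G * (2 * D') <= e / 2.
  have : D' <= e / (4 * (G + 1)) by rewrite ge_min lexx orbT.
  by rewrite ler_pdivlMr// => H; move: H D'0 G0; clear; nra.
have [b' [W [b'0 W0 wP]]] := bP D' D'0.
have e2 : 0 < e / 2 by rewrite divr_gt0.
have xb'0 : qn I (inA x ^+ n.+1) <= b' by rewrite -/X xq ltW.
have [w [_ wD wD' we]] := wP x xB xb xb'0 _ e2; rewrite -/X in wD wD' we.
have [j Ij jd] := qn_adherent I (X * w - X) D'0.
have [i Ii jE] := Ij.
exists (x - i); rewrite raddfB/= -jE -/X.
have xX : X - j - X = - j by ncring.
have dist : opn ((X - j) - X * w) <= 2 * D'.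
  have -> : X - j - X * w = - (X * w - X + j) by ncring.
  by rewrite opnN; move: jd wD'; clear; lra.
have near : opn (X - j - X) <= D.
  have -> : X - j - X = (X - j - X * w) + (X * w - X) by ncring.
  by apply: le_trans (opnD _ _) _; move: dist wD D'D; clear; lra.
split => //; first by rewrite xX; exact: inIN.
have XB : opn X <= B by rewrite opn_inA.
have Xc S : opn (S - X) <= D -> opn S <= c.
  move=> SX; rewrite -[S](subrK X); apply: le_trans (opnD _ _) _.
  by move: SX XB; rewrite /c; clear; lra.
have wc : opn (X * w) <= c by apply: Xc; move: wD D0; clear; lra.
have := opn_powB n.+1 c1 (Xc _ near) wc dist; rewrite -/G => H.
rewrite -(subrK ((X * w) ^+ n.+1) ((X - j) ^+ n.+1)).
by apply: le_trans (opnD _ _) _; move: H D'e we; clear; lra.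
Qed.

Lemma exists_pos_lower_bound (c : nat -> R) N :
  exists2 m : R, 0 < m & forall n, (n <= N)%N -> 0 < c n -> m <= c n.
Proof.
elim: N => [|N [m m0 mP]].
  have [c0|c0] := ltP 0 (c 0%N).
    by exists (c 0%N) => // n; rewrite leqn0 => /eqP ->.
  by exists 1 => // n; rewrite leqn0 => /eqP ->; rewrite ltNge c0.
have [cN|cN] := ltP 0 (c N.+1).
  exists (Num.min m (c N.+1)); first by rewrite lt_min m0.
  move=> n; rewrite leq_eqVlt => /orP[/eqP-> _|nN cn].
    by rewrite ge_min lexx orbT.
  by rewrite ge_min mP.
exists m => // n; rewrite leq_eqVlt => /orP[/eqP->|nN]; last exact: mP.
by rewrite ltNge cN.
Qed.

(** The indices with vanishing quotient norm are left essentially unchanged; for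
    the others the scaling factor 1 - t = m / (m + a) reduces c + a to at most c,
    for every c >= m. *)
Lemma scale_adjust (x0 : A) N (B D : R) : 0 < B -> 0 < D ->
  exists2 a : R, 0 < a & forall x, inI I (inA x - inA x0) -> nm x <= B ->
    (forall n, (0 < n <= N)%N -> 0 < qn I (inA x0 ^+ n) ->
       opn (inA x ^+ n) <= qn I (inA x0 ^+ n) + a) ->
    forall e : R, 0 < e -> exists x' : A,
    [/\ inI I (inA x' - inA x0), opn (inA x' - inA x) <= D &
      forall n, (0 < n <= N)%N -> opn (inA x' ^+ n) <=
       (if 0 < qn I (inA x0 ^+ n) then qn I (inA x0 ^+ n) else opn (inA x ^+ n)) + e].
Proof.
move=> B0 D0.
have [m m0 mP] := exists_pos_lower_bound (fun n => qn I (inA x0 ^+ n)) N.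
pose a := m * D / (2 * B); have a0 : 0 < a by rewrite divr_gt0 ?mulr_gt0.
exists a => // x xx0 xB xa e e0; set X := inA x in xx0 xa *; set X0 := inA x0 in xx0 xa mP *.
pose t := a / (m + a); have ma : 0 < m + a by lra.
have t01 : 0 <= t <= 1.
  by rewrite divr_ge0 ?(ltW a0) ?(ltW ma)//= ler_pdivrMr//; lra.
have tB : t * (2 * B) <= D.
  have : t <= a / m.
    by rewrite ler_wpM2l ?(ltW a0)// lef_pV2 ?posrE//; lra.
  rewrite -(@ler_pM2r _ (2 * B)) ?mulr_gt0// => /le_trans; apply.
  rewrite le_eqVlt; apply/orP; left; apply/eqP; rewrite /a; field.
  by rewrite !lt0r_neq0.
have [u uc uP] := norm_adjust I X N t01 e0.
have [Iu su u1] := uc; have u2 := cutoff_le2 uc.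
have [x' x'E] : exists x', X * (1 - t%:C *: u) = inA x'.
  by rewrite /X -inAMl; eexists.
have diff : X * (1 - t%:C *: u) - X = - (t%:C *: (X * u)).
  by rewrite mulrBr mulr1 scalerAr; set P := X * _; ncring.
have qX n : qn I (X ^+ n) = qn I (X0 ^+ n) by apply: qn_congr; exact: inI_powB.
exists x'; rewrite -x'E; split.
- have -> : X * (1 - t%:C *: u) - X0 = (X * (1 - t%:C *: u) - X) + (X - X0) by ncring.
  by apply: inID => //; rewrite diff; apply/inIN/inIZ/inIMl.
- rewrite diff opnN opnZ_real; last by case/andP: t01.
  apply: le_trans tB; rewrite ler_wpM2l; [|by case/andP: t01|].
    done.
  rewrite mulrC; apply: le_trans (opnM _ _) _.
  by apply: ler_pM; rewrite ?opn_ge0 ?opn_inA.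
move=> n nN; apply: le_trans (uP n nN) _; rewrite lerD2r qX ge_max.
have [cn|cn] := ltP 0 (qn I (X0 ^+ n)).
  rewrite lexx/=; have nN' : (n <= N)%N by case/andP: nN.
  have mc := mP n nN' cn; have xc := xa n nN cn.
  apply: (@le_trans _ _ ((1 - t) * (qn I (X0 ^+ n) + a))).
    by rewrite ler_wpM2l//; move: t01; clear; lra.
  have -> : 1 - t = m / (m + a) by rewrite /t; field; exact: lt0r_neq0.
  rewrite mulrAC ler_pdivrMr//; move: mc a0; set q := qn _ _; clear; nra.
apply/andP; split; first by apply: le_trans cn _; exact: opn_ge0.
by rewrite ler_piMl ?opn_ge0//; move: t01; clear; lra.
Qed.

(** If the N-th quotient norm vanishes, x is first moved towards an element with
    zero N-th power.  This enlarges the lower powers by an amount controlled by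
    the length of the move, which the rescaling then removes. *)
Lemma power_adjust (x0 : A) N (D : R) :
  (forall n, (0 < n < N)%N -> 0 < qn I (inA x0 ^+ n)) -> 0 < D ->
  exists2 a : R, 0 < a & forall x, inI I (inA x - inA x0) ->
    (forall n, (0 < n <= N)%N -> opn (inA x ^+ n) <= qn I (inA x0 ^+ n) + a) ->
    forall e : R, 0 < e -> exists x' : A,
    [/\ inI I (inA x' - inA x0), opn (inA x' - inA x) <= D &
      forall n, (0 < n <= N)%N -> opn (inA x' ^+ n) <= qn I (inA x0 ^+ n) + e].
Proof.
case: N => [|N] cpos D0.
  by exists 1 => // x xx0 _ e e0; exists x; split; rewrite ?subrr ?opn0 ?(ltW D0)// => -[].
pose c n := qn I (inA x0 ^+ n); have c_ge0 n : 0 <= c n by exact: qn_ge0.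
pose B := c 1%N + 1; have B0 : 0 < B by rewrite ltr_wpDl.
have D2 : 0 < D / 2 by lra.
have BD : 0 < B + D by lra.
have [a a0 aP] := scale_adjust x0 N.+1 BD D2.
have nmB (x : A) (d : R) : d <= 1 -> opn (inA x ^+ 1) <= c 1%N + d -> nm x <= B.
  by rewrite expr1 opn_inA /B => ? ?; lra.
have [cN|cN] := ltP 0 (c N.+1).
  have allpos n : (0 < n <= N.+1)%N -> 0 < c n.
    move=> /andP[n0]; rewrite leq_eqVlt => /orP[/eqP->//|nN].
    by apply: cpos; rewrite n0.
  exists (Num.min a 1); first by rewrite lt_min a0 ltr01.
  move=> x xx0 xc e e0.
  have xB : nm x <= B + D.
    by have := @nmB x (Num.min a 1) _ (xc 1%N isT); rewrite ge_min lexx orbT => /(_ isT); lra.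
  have [|x' [x'I x'D x'P]] := aP x xx0 xB _ e e0.
    move=> n nN _; apply: le_trans (xc n nN) _.
    by rewrite lerD2l ge_min lexx.
  exists x'; split => //; first by move: x'D D0; clear; lra.
  by move=> n nN; have := x'P n nN; rewrite -/(c n) allpos.
have c0 : c N.+1 = 0 by apply/le_anti; rewrite cN c_ge0.
pose K := 1 + B + D; have K1 : 1 <= K by rewrite /K; lra.
pose G := \sum_(n < N.+2) n%:R * K ^+ n.
have K0 : 0 <= K by lra.
have Gn n : (n <= N.+1)%N -> n%:R * K ^+ n <= G.
  move=> nN; rewrite /G (bigD1 (Ordinal (nN : (n < N.+2)%N)))//= lerDl.
  by apply: sumr_ge0 => i _; rewrite mulr_ge0// exprn_ge0.
have G0 : 0 <= G by have := Gn 0%N isT; rewrite mul0r.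
pose d := Num.min (D / 2) (a / (2 * (G + 1))).
have G1 : 0 < 2 * (G + 1) by rewrite mulr_gt0// ltr_wpDl.
have d0 : 0 < d by rewrite lt_min D2 divr_gt0.
have dD : d <= D / 2 by rewrite ge_min lexx.
have dG : G * d <= a / 2.
  have : d <= a / (2 * (G + 1)) by rewrite ge_min lexx orbT.
  by rewrite ler_pdivlMr// => H; move: H d0; clear; nra.
have [b b0 bP] := nilpotent_lift_adjust N B0 d0.
pose a1 := Num.min b (Num.min (a / 2) 1).
have a10 : 0 < a1 by rewrite /a1 !lt_min b0 ltr01 andbT/= divr_gt0.
have a1b : a1 <= b by rewrite ge_min lexx.
have a1a : a1 <= a / 2 by rewrite !ge_min lexx !orbT.
have a11 : a1 <= 1 by rewrite !ge_min lexx !orbT.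
exists a1 => // x xx0 xc e e0.
have xB : nm x <= B by apply: (nmB _ a1 a11); exact: (xc 1%N isT).
have xN : opn (inA x ^+ N.+1) <= b.
  apply: le_trans (xc N.+1 _) _; first by rewrite leqnn.
  by rewrite -/(c N.+1) c0 add0r.
have qx : qn I (inA x ^+ N.+1) = 0.
  by rewrite -c0; apply: qn_congr; exact: inI_powB.
have e2 : 0 < e / 2 by rewrite divr_gt0.
have [y [yI yd yN]] := bP x xB xN qx _ e2.
have yx0 : inI I (inA y - inA x0).
  have -> : inA y - inA x0 = (inA y - inA x) + (inA x - inA x0) by ncring.
  exact: inID.
have yB : nm y <= B + D.
  rewrite -opn_inA -(subrK (inA x) (inA y)); apply: le_trans (opnD _ _) _.
  by move: xB yd dD D0; rewrite -opn_inA; clear; lra.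
have [|x' [x'I x'D x'P]] := aP y yx0 yB _ _ e2.
  move=> n nN _; rewrite -/(c n) -(subrK (inA x ^+ n) (inA y ^+ n)).
  apply: le_trans (opnD _ _) _.
  have yK : opn (inA y) <= K by rewrite opn_inA; move: yB; rewrite /K; clear; lra.
  have xK : opn (inA x) <= K by rewrite opn_inA; move: xB D0; rewrite /K; clear; lra.
  have H1 := opn_powB n K1 yK xK yd.
  have H2 : n%:R * K ^+ n * d <= G * d.
    by rewrite ler_wpM2r ?(ltW d0)// Gn//; case/andP: nN.
  have H3 := xc n nN; rewrite -/(c n) in H3.
  by move: H1 H2 H3 a1a dG; clear; lra.
exists x'; split => //.
  have -> : inA x' - inA x = (inA x' - inA y) + (inA y - inA x) by ncring.
  by apply: le_trans (opnD _ _) _; move: x'D yd dD; clear; lra.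
move=> n nN; have := x'P n nN; rewrite -/(c n).
have [cn|cn] := ltP 0 (c n); first by move: e0; clear; lra.
suff -> : n = N.+1 by move: yN; rewrite c0; clear; lra.
have /andP[n0] := nN; rewrite leq_eqVlt => /orP[/eqP//|nN1].
by have := cpos n; rewrite n0 nN1 -/(c n) ltNge cn => /(_ isT).
Qed.

(** The m-th step moves the lift by at most D m = 2^-m. *)
Lemma power_lift (x0 : A) N :
  (forall n, (0 < n < N)%N -> 0 < qn I (inA x0 ^+ n)) ->
  exists2 x : A, inI I (inA x - inA x0) &
    forall n, (0 < n <= N)%N -> opn (inA x ^+ n) <= qn I (inA x0 ^+ n).
Proof.
move=> cpos; pose c n := qn I (inA x0 ^+ n).
pose D (m : nat) : R := 2^-1 ^+ m.
have D0 m : 0 < D m by rewrite exprn_gt0// invr_gt0.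
have /choice[a aP] : forall m, exists am : R, 0 < am /\ forall x,
    inI I (inA x - inA x0) ->
    (forall n, (0 < n <= N)%N -> opn (inA x ^+ n) <= c n + am) ->
    forall e : R, 0 < e -> exists x' : A,
    [/\ inI I (inA x' - inA x0), opn (inA x' - inA x) <= D m &
      forall n, (0 < n <= N)%N -> opn (inA x' ^+ n) <= c n + e].
  by move=> m; have [a a0 aP] := power_adjust cpos (D0 m); exists a.
pose r m := Num.min (a m) (D m).
have r0 m : 0 < r m by rewrite lt_min (aP m).1 D0.
pose good m (x : A) := inI I (inA x - inA x0) /\
  forall n, (0 < n <= N)%N -> opn (inA x ^+ n) <= c n + r m.
have /choice[step stepP] : forall p : nat * A, exists y, good p.1 p.2 ->
    good p.1.+1 y /\ opn (inA y - inA p.2) <= D p.1.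
  move=> [m x]/=.
  have [gx|ngx] := pselect (good m x); last by exists x.
  have [|x' [x'I x'D x'P]] := (aP m).2 x gx.1 _ _ (r0 m.+1).
    by move=> n nN; apply: le_trans (gx.2 n nN) _; rewrite lerD2l ge_min lexx.
  by exists x' => _; split.
have [u0 u0good] : exists u0, good 0%N u0.
  have t01 : 0 <= (1 : R) <= 1 by rewrite ler01 lexx.
  (* with t = 1 the rescaling reduces all powers to their quotient norms *)
  have [u [Iu _ _] uP] := norm_adjust I (inA x0) N t01 (r0 0%N).
  have [y yE] : exists y, inA x0 * (1 - (1 : R)%:C *: u) = inA y.
    by rewrite -inAMl; eexists.
  exists y; rewrite /good -yE rmorph1 scale1r; split.
    have -> : inA x0 * (1 - u) - inA x0 = - (inA x0 * u) by ncring.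
    by apply/inIN/inIMl.
  move=> n nN; have := uP n nN; rewrite rmorph1 scale1r subrr mul0r.
  by rewrite max_l ?qn_ge0.
pose u := fix u m := if m is m'.+1 then step (m', u m') else u0.
have ugood m : good m (u m).
  by elim: m => [|m IH]//=; have [] := stepP (m, u m) IH.
have udist m : nm (u m.+1 - u m) <= D m.
  by have [_] := stepP (m, u m) (ugood m); rewrite -raddfB opn_inA.
have utail m k : nm (u (m + k)%N - u m) <= 2 * D m - 2 * D (m + k)%N.
  elim: k => [|k IH]; first by rewrite addn0 !subrr nm0.
  rewrite addnS -(subrK (u (m + k)%N) (u (m + k).+1)) -addrA.
  apply: le_trans (nmD _ _) _; have := udist (m + k)%N.
  have -> : D (m + k).+1 = 2^-1 * D (m + k)%N by rewrite /D exprS.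
  by move: IH; clear; lra.
have Dsmall (e : R) : 0 < e -> exists m, 2 * D m <= e.
  move=> e0; pose m := Num.bound (2 / e); exists m.
  have : 2 / e < (2 ^ m)%:R :> R.
    apply: lt_trans (archi_boundP _) _; first by rewrite divr_ge0// ltW.
    by rewrite ltr_nat ltn_expl.
  rewrite ltr_pdivrMr// natrX => H.
  by rewrite /D exprVn ler_pdivrMr ?exprn_gt0// mulrC ltW.
have udist2 m n : (m <= n)%N -> nm (u n - u m) <= 2 * D m.
  move=> /subnKC <-; apply: le_trans (utail m _) _.
  by have := D0 (m + (n - m))%N; clear; lra.
have [|l lP] := @nm_complete _ _ u.
  move=> e e0; have e2 : 0 < e / 2 by rewrite divr_gt0.
  have [m0 m0P] := Dsmall _ e2; exists m0 => m n mm nm.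
  have -> : u m - u n = (u m - u m0) - (u n - u m0).
    by apply: (@inA_inj _ A); rewrite !raddfB/=; ncring.
  apply: le_trans (nmD _ _) _; rewrite nmN.
  by have := udist2 _ _ mm; have := udist2 _ _ nm; move: m0P; clear; lra.
have lI : ideal_set I (l - x0).
  apply: inI_closed => d d0; have [m0 m0P] := lP _ d0.
  have [[b Ib bE] _] := ugood m0; exists b => //.
  have -> : l - x0 - b = - (u m0 - l).
    apply: (@inA_inj _ A); rewrite raddfN !raddfB/= -bE; ncring.
  by rewrite nmN m0P.
exists l; first by exists (l - x0) => //; rewrite raddfB.
move=> n nN; apply/ler_addgt0Pl => e e0.
pose K := 2 + nm l; have K1 : 1 <= K by rewrite /K; have := nm_ge0 l; clear; lra.
pose G := n%:R * K ^+ n.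
have G0 : 0 <= G by rewrite mulr_ge0// exprn_ge0// (le_trans ler01 K1).
pose d := Num.min 1 (e / (2 * (G + 1))).
have G1 : 0 < 2 * (G + 1) by rewrite mulr_gt0// ltr_wpDl.
have d0 : 0 < d by rewrite lt_min ltr01 divr_gt0.
have d1 : d <= 1 by rewrite ge_min lexx.
have dG : G * d <= e / 2.
  have : d <= e / (2 * (G + 1)) by rewrite ge_min lexx orbT.
  by rewrite ler_pdivlMr// => H; move: H d0; clear; nra.
have [m1 m1P] := lP _ d0; have [m2 m2P] := Dsmall _ e0.
pose m := maxn m1 m2.
have ul : opn (inA l - inA (u m)) <= d.
  by rewrite -raddfB opn_inA -nmN opprB m1P// leq_maxl.
have rm : r m <= e / 2.
  have : r m <= D m by rewrite ge_min lexx orbT.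
  have : D m <= D m2 by rewrite ler_wiXn2l ?leq_maxr// ?invr_ge0// invf_le1// ler1n.
  by move: m2P; clear; lra.
have lK : opn (inA l) <= K by rewrite opn_inA /K; clear; lra.
have uK : opn (inA (u m)) <= K.
  have -> : inA (u m) = inA l - (inA l - inA (u m)) by ncring.
  apply: le_trans (opnD _ _) _; rewrite opnN opn_inA /K.
  by move: ul d1; clear; lra.
have H := opn_powB n K1 lK uK ul.
rewrite -(subrK (inA (u m) ^+ n) (inA l ^+ n)); apply: le_trans (opnD _ _) _.
have [_ /(_ n nN) um] := ugood m.
by move: H um rm dG; rewrite -/G /c; clear; lra.
Qed.

Lemma quot_norm_qn (a : A) : `|\pi_(cquot I) a| = (qn I (inA a))%:C.
Proof.
congr (_%:C); apply/le_anti/andP; split.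
  apply: le_qn => j [b Ib ->]; rewrite -raddfD opn_inA.
  apply: ge_inf; first by exists 0 => _ [y _ <-]; exact: nm_ge0.
  by exists (a + b) => //=; apply/pi_cquotP; rewrite addrC addKr.
apply: lb_le_inf; first by exists (nm a), a.
move=> _ [y /= /pi_cquotP Iy <-].
rewrite -[complex.Re _]/(nm y) -opn_inA -(subrKC (inA a) (inA y)).
by apply: qn_le; exists (y - a); rewrite ?raddfB.
Qed.

End Lifting.

Theorem theorem2p2 (R : realType) (A : cstarAlgType R) (I : ideal A) (x : A)
    (N : nat) :
  exists xbar : A,
    \pi_(cquot I) xbar = \pi_(cquot I) x /\
    forall n : nat, (1 <= n <= N)%N ->
      `|cpow xbar n| = `|\pi_(cquot I) (cpow x n)|.
Proof.
have [k [kpos kN]] : exists k, (forall n, (0 < n < k)%N -> 0 < qn I (inA x ^+ n)) /\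
    ((N <= k)%N \/ (0 < k)%N /\ qn I (inA x ^+ k) = 0).
  have [ex|nex] := pselect (exists n, (0 < n)%N && (qn I (inA x ^+ n) == 0)).
    exists (ex_minn ex); case: ex_minnP => k /andP[k0 /eqP kz] kmin; split; last by right.
    move=> n /andP[n0 nk]; rewrite lt_def qn_ge0 andbT; apply/negP => nz.
    by have := kmin n; rewrite n0 nz leqNgt nk => /(_ isT).
  exists N; split; last by left.
  move=> n /andP[n0 _]; rewrite lt_def qn_ge0 andbT; apply/negP => nz.
  by apply: nex; exists n; rewrite n0.
have [y yI yP] := power_lift kpos.
exists y; split.
  apply/pi_cquotP; have [b Ib] := yI; rewrite -raddfB => /inA_inj -> //.
move=> [|n]// /andP[_ nN]; rewrite quot_norm_qn -nmE -opn_inA !inA_cpow.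
congr (_%:C); apply/le_anti/andP; split; last first.
  by rewrite -(qn_congr (inI_powB n.+1 yI)) qn_le_opn.
have [nk|kn] := leqP n.+1 k; first by apply: yP.
case: kN => [Nk|[k0 kz]]; first by rewrite ltnNge (leq_trans nN Nk) in kn.
apply: le_trans (qn_ge0 _ _).
rewrite -(subnK (ltnW kn)) exprD; apply: le_trans (opnM _ _) _.
by rewrite mulr_ge0_le0 ?opn_ge0// -kz yP// k0 leqnn.
Qed.
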